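(* Let $\mathbb{K}$ be a field of characteristic $0$, let $n,k\geq 1$ be integers, let $a\in\mathbb{K}$, and let $f_1,\ldots,f_n\in\mathbb{K}[u]$ and $Q_1,\ldots,Q_n\in\mathbb{K}[y_1,\ldots,y_{n(k+1)},t,u]$ be polynomials. For $F\in\mathbb{K}[u][[t]]$ set $\Delta_a F(t,u):=\frac{F(t,u)-F(t,a)}{u-a}$ and $\nabla_a^kF:=(F,\Delta_aF,\ldots,\Delta_a^kF)$, where $\Delta_a^j$ denotes the $j$-th iterate of $\Delta_a$. Then the system of equations $$F_i = f_i(u) + t\cdot Q_i(\nabla_a^kF_1,\ldots,\nabla_a^kF_n,t,u),\qquad i=1,\ldots,n,$$ admits a unique solution $(F_1,\ldots,F_n)\in\mathbb{K}[u][[t]]^n$, and each component $F_i$ is algebraic over $\mathbb{K}(t,u)$. *)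

(* Defs.v *)
From HB Require Import structures.
From mathcomp Require Import all_boot all_order all_algebra.
From mathcomp Require Import boolp.
From mathcomp Require Import mpoly.

Set Implicit Arguments.
Unset Strict Implicit.
Unset Printing Implicit Defensive.

Import GRing.Theory.
Local Open Scope ring_scope.

Record pseries (R : Type) := PSeries { pscoef : nat -> R }.

Notation "{ 'pseries' R }" := (pseries R)
  (at level 0, format "{ 'pseries'  R }") : type_scope.

Lemma pseriesP (R : Type) (F G : {pseries R}) :
  (forall m, pscoef F m = pscoef G m) -> F = G.
Proof. by case: F G => [F] [G] /= FG; congr PSeries; apply: funext. Qed.

(* infinite sequences have neither decidable equality nor a choice operator
   constructively *)
HB.instance Definition _ (R : Type) := gen_eqMixin {pseries R}.
HB.instance Definition _ (R : Type) := gen_choiceMixin {pseries R}.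

Section PSeriesZmod.
Variable R : zmodType.
Implicit Types F G : {pseries R}.

Definition ps_zero : {pseries R} := PSeries (fun=> 0).
Definition ps_opp F := PSeries (fun m => - pscoef F m).
Definition ps_add F G := PSeries (fun m => pscoef F m + pscoef G m).

Fact ps_addA : associative ps_add.
Proof. by move=> F G H; apply: pseriesP => m /=; rewrite addrA. Qed.
Fact ps_addC : commutative ps_add.
Proof. by move=> F G; apply: pseriesP => m /=; rewrite addrC. Qed.
Fact ps_add0 : left_id ps_zero ps_add.
Proof. by move=> F; apply: pseriesP => m /=; rewrite add0r. Qed.
Fact ps_addN : left_inverse ps_zero ps_opp ps_add.
Proof. by move=> F; apply: pseriesP => m /=; rewrite addNr. Qed.

HB.instance Definition _ :=
  GRing.isZmodule.Build {pseries R} ps_addA ps_addC ps_add0 ps_addN.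

Lemma pscoef0 m : pscoef (0 : {pseries R}) m = 0. Proof. by []. Qed.
Lemma pscoefN F m : pscoef (- F) m = - pscoef F m. Proof. by []. Qed.
Lemma pscoefD F G m : pscoef (F + G) m = pscoef F m + pscoef G m.
Proof. by []. Qed.
Lemma pscoefB F G m : pscoef (F - G) m = pscoef F m - pscoef G m.
Proof. by []. Qed.

End PSeriesZmod.

Section PSeriesRing.
Variable R : comNzRingType.
Implicit Types F G : {pseries R}.

Definition ps_of_poly (p : {poly R}) : {pseries R} := PSeries (fun m => p`_m).

Definition ps_mul F G :=
  PSeries (fun m => \sum_(i < m.+1) pscoef F i * pscoef G (m - i)%N).

(* truncations reduce the ring laws to those of polynomials *)
Let trunc N F := \poly_(i < N) pscoef F i.

Let trunc_coef N F m : (m < N)%N -> (trunc N F)`_m = pscoef F m.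
Proof. by move=> mN; rewrite /trunc coef_poly mN. Qed.

Let mul_trunc N F G m :
  (m < N)%N -> pscoef (ps_mul F G) m = (trunc N F * trunc N G)`_m.
Proof.
move=> mN; rewrite coefM /=; apply: eq_bigr => i _.
have im : (i <= m)%N by rewrite -ltnS.
rewrite !trunc_coef //; last exact: leq_ltn_trans mN.
by apply: leq_ltn_trans mN; rewrite leq_subr.
Qed.

Fact ps_mulC : commutative ps_mul.
Proof.
by move=> F G; apply: pseriesP => m; rewrite !(@mul_trunc m.+1) // mulrC.
Qed.

Fact ps_mulA : associative ps_mul.
Proof.
have H F G H m : pscoef (ps_mul (ps_mul F G) H) m =
    (trunc m.+1 F * trunc m.+1 G * trunc m.+1 H)`_m.
  rewrite coefM; apply: eq_bigr => i _.
  by rewrite -(@mul_trunc m.+1) // trunc_coef // ltnS leq_subr.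
move=> F G K; apply: pseriesP => m.
by rewrite ps_mulC !H mulrC mulrA.
Qed.

Fact ps_mul1 : left_id (ps_of_poly 1) ps_mul.
Proof.
move=> F; apply: pseriesP => m /=.
rewrite big_ord_recl big1 ?addr0 => [|i _]; rewrite coef1 ?mul0r //.
by rewrite mul1r subn0.
Qed.

Fact ps_mulDl : left_distributive ps_mul +%R.
Proof.
move=> F G H; apply: pseriesP => m /=.
by rewrite -big_split; apply: eq_bigr => i _; rewrite mulrDl.
Qed.

Fact ps_oner_neq0 : ps_of_poly 1 != 0.
Proof.
apply/eqP => /(congr1 (fun F => pscoef F 0)) /=.
by rewrite coef1 => /eqP; rewrite oner_eq0.
Qed.

HB.instance Definition _ := GRing.Zmodule_isComNzRing.Build {pseries R}
  ps_mulA ps_mulC ps_mul1 ps_mulDl ps_oner_neq0.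

Lemma pscoefM F G m :
  pscoef (F * G) m = \sum_(i < m.+1) pscoef F i * pscoef G (m - i)%N.
Proof. by []. Qed.

Fact ps_of_poly_zmod_morphism : zmod_morphism ps_of_poly.
Proof. by move=> p q; apply: pseriesP => m; rewrite /= coefB. Qed.
Fact ps_of_poly_monoid_morphism : monoid_morphism ps_of_poly.
Proof. by split=> // p q; apply: pseriesP => m; rewrite /= coefM. Qed.

HB.instance Definition _ := GRing.isZmodMorphism.Build {poly R} {pseries R}
  ps_of_poly ps_of_poly_zmod_morphism.
HB.instance Definition _ := GRing.isMonoidMorphism.Build {poly R} {pseries R}
  ps_of_poly ps_of_poly_monoid_morphism.

Lemma ps_of_poly_inj : injective ps_of_poly.
Proof.
move=> p q pq; apply/polyP => m.
exact: (congr1 (fun F => pscoef F m) pq).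
Qed.

Definition ps_unit : pred {pseries R} := fun F => `[< exists G, G * F = 1 >].
Definition ps_inv F : {pseries R} :=
  if pselect (exists G, G * F = 1) is left FP then sval (cid FP) else F.

Fact ps_mulVr : {in ps_unit, left_inverse 1 ps_inv *%R}.
Proof.
move=> F /asboolP FP; rewrite /ps_inv; case: pselect => // FP'.
by case: cid.
Qed.
Fact ps_unitP F G : G * F = 1 -> ps_unit F.
Proof. by move=> GF; apply/asboolP; exists G. Qed.
Fact ps_inv_out : {in [predC ps_unit], ps_inv =1 id}.
Proof.
by move=> F /asboolPn FP; rewrite /ps_inv; case: pselect.
Qed.

HB.instance Definition _ := GRing.ComNzRing_hasMulInverse.Build {pseries R}
  ps_mulVr ps_unitP ps_inv_out.

End PSeriesRing.

Section PSeriesIdomain.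
Variable R : idomainType.

Fact ps_mulf_eq0 (F G : {pseries R}) : F * G = 0 -> (F == 0) || (G == 0).
Proof.
have ord (H : {pseries R}) : H != 0 ->
    exists2 m, pscoef H m != 0 & forall i, (i < m)%N -> pscoef H i = 0.
  move=> Hn0; have ex : exists m, pscoef H m != 0.
    apply: contrapT => nex; case/eqP: Hn0; apply: pseriesP => m.
    by apply/eqP/negPn/negP => Hm; apply: nex; exists m.
  exists (ex_minn ex); case: ex_minnP => // m _ min i im.
  by apply/eqP/negPn/negP => /min; rewrite leqNgt im.
move=> FG0; apply/norP => -[/ord[p Fp Fmin] /ord[q Gq Gmin]].
have := congr1 (fun F => pscoef F (p + q)) FG0.
rewrite pscoefM pscoef0.
have pP : (p < (p + q).+1)%N by rewrite ltnS leq_addr.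
rewrite (bigD1 (Ordinal pP)) //= big1 ?addr0 => [|i].
  by rewrite addKn => /eqP; rewrite mulf_eq0 (negPf Fp) (negPf Gq).
rewrite -val_eqE /= neq_ltn => /orP[/Fmin->|pi]; first by rewrite mul0r.
by rewrite (Gmin (p + q - i)%N) ?mulr0 // ltn_subLR ?ltn_add2r // -ltnS.
Qed.

HB.instance Definition _ :=
  GRing.ComUnitRing_isIntegral.Build {pseries R} ps_mulf_eq0.

End PSeriesIdomain.

Section FracMap.
Variables (R S : idomainType) (f : {rmorphism R -> S}).

Definition frac_map (x : {fraction R}) : {fraction S} :=
  tofrac (f \n_(repr x)) / tofrac (f \d_(repr x)).

Lemma frac_reprE (x : {fraction R}) :
  x = tofrac \n_(repr x) / tofrac \d_(repr x).
Proof.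
apply/(canRL (mulfK _)); first by rewrite tofrac_eq0 denom_ratioP.
rewrite -{1}[x]reprK; set r := repr x; unlock FracField.tofrac.
rewrite -[LHS]FracField.pi_mul; apply/eqmodP => /=.
rewrite FracField.equivfE /FracField.mulf.
by rewrite !numden_Ratio ?mulf_neq0 ?oner_neq0 ?denom_ratioP // !mulr1 mulrC.
Qed.

Hypothesis f_inj : injective f.

Lemma frac_mapE n d : d != 0 ->
  frac_map (tofrac n / tofrac d) = tofrac (f n) / tofrac (f d).
Proof.
have f0 x : x != 0 -> tofrac (f x) != 0.
  by move=> x0; rewrite tofrac_eq0 -(rmorph0 f) (inj_eq f_inj).
move=> d0; set x := _ / _; have := frac_reprE x; rewrite {1}/x => /eqP.
have r0 : \d_(repr x) != 0 by rewrite denom_ratioP.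
rewrite eqr_div ?tofrac_eq0 // -!tofracM tofrac_eq => /eqP e.
apply/eqP; rewrite /frac_map -/x eq_sym eqr_div ?f0 // -!tofracM -!rmorphM.
by rewrite e.
Qed.

Fact frac_map_zmod_morphism : zmod_morphism frac_map.
Proof.
have f0 x : x != 0 -> tofrac (f x) != 0.
  by move=> x0; rewrite tofrac_eq0 -(rmorph0 f) (inj_eq f_inj).
move=> x y; have xE := frac_reprE x; have yE := frac_reprE y.
have x0 := denom_ratioP (repr x); have y0 := denom_ratioP (repr y).
rewrite {1}xE {1}yE -mulNr addf_div ?tofrac_eq0 // -tofracN -!tofracM -tofracD.
rewrite frac_mapE ?mulf_neq0 // rmorphD !rmorphM rmorphN tofracD !tofracM.
by rewrite tofracN /frac_map -[in RHS]mulNr addf_div ?f0.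
Qed.

Fact frac_map_monoid_morphism : monoid_morphism frac_map.
Proof.
split=> [|x y].
  have := frac_mapE 1 (oner_neq0 R).
  by rewrite rmorph1 !tofrac1 !divr1.
have x0 := denom_ratioP (repr x); have y0 := denom_ratioP (repr y).
rewrite {1}[x]frac_reprE {1}[y]frac_reprE mulf_div -!tofracM.
by rewrite frac_mapE ?mulf_neq0 // !rmorphM -mulf_div.
Qed.

End FracMap.

Section RationalFunctions.
Variable K : fieldType.

(* K(t,u): the outer polynomial variable is t, the inner one u *)
Local Notation ratfun := {fraction {poly {poly K}}}.

(* K(t,u) -> Frac(K[u][[t]]), induced by K[u][t] -> K[u][[t]] *)
Definition ratfun_embed : ratfun -> {fraction {pseries {poly K}}} :=
  frac_map (@ps_of_poly {poly K}).

HB.instance Definition _ := GRing.isZmodMorphism.Build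
  ratfun {fraction {pseries {poly K}}} ratfun_embed
  (frac_map_zmod_morphism (@ps_of_poly_inj {poly K})).
HB.instance Definition _ := GRing.isMonoidMorphism.Build
  ratfun {fraction {pseries {poly K}}} ratfun_embed
  (frac_map_monoid_morphism (@ps_of_poly_inj {poly K})).

End RationalFunctions.

Section DiscreteDifferentialSystem.
Variable K : fieldType.
Local Notation Kut := {pseries {poly K}}.

Definition ps_t : Kut := ps_of_poly 'X.
Definition ps_inu (p : {poly K}) : Kut := ps_of_poly p%:P.

Definition ps_eval (a : K) (F : Kut) : Kut :=
  PSeries (fun m => (pscoef F m).[a]%:P).

(* the division by u - a is exact, see DeltaP *)
Definition Delta (a : K) (F : Kut) : Kut :=
  PSeries (fun m => pscoef (F - ps_eval a F) m %/ ('X - a%:P)).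

Lemma DeltaP a F : ps_inu ('X - a%:P) * Delta a F = F - ps_eval a F.
Proof.
apply: pseriesP => m; rewrite pscoefM big_ord_recl big1 ?addr0 => [|i _].
  rewrite /= coefC subn0 mulrC divpK // dvdp_XsubCl /root.
  by rewrite hornerD hornerN hornerC subrr.
by rewrite /= coefC mul0r.
Qed.

Definition nabla (a : K) (k : nat) (F : Kut) : 'rV[Kut]_k.+1 :=
  \row_(j < k.+1) iter j (Delta a) F.

Variables (n k : nat).

(* mxvec lists the nabla a k (F i) one after the other, as the values of
   y_1, ..., y_{n(k+1)}; the last two variables are t and u *)
Definition system_point (a : K) (F : {ffun 'I_n -> Kut}) :
    'rV[Kut]_(n * k.+1 + 2) :=
  row_mx (mxvec (\matrix_(i < n) nabla a k (F i)))
         (\row_(j < 2) if j == 0 then ps_t else ps_inu 'X).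

Definition system_rhs (a : K) (f : {poly K}) (Q : {mpoly K[n * k.+1 + 2]})
    (F : {ffun 'I_n -> Kut}) : Kut :=
  ps_inu f + ps_t * mmap (fun c : K => ps_inu c%:P) (system_point a F 0) Q.

End DiscreteDifferentialSystem.

(* Main.v *)
From HB Require Import structures.
Require Import Defs.
From mathcomp Require Import all_boot all_order all_algebra.
From mathcomp Require Import boolp classical_sets.
From mathcomp Require Import mpoly.
From mathcomp Require Import ring zify.

(* Modulo t^m, the right-hand sides depend only on the F_i modulo t^(m-1), so
   existence and uniqueness are those of the fixed point of a contraction.

   For algebraicity, put H_j = Delta^k F_j and let G_jm in K[[t]] be the value
   of Delta^m F_j at u = a, for m < k. The F_j and their Delta^l F_j are
   polynomials in G, H and u - a, and the system becomes P(G, H) = 0, where the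
   Jacobian determinant with respect to H is (u - a)^(nk) modulo t. If some G_jm
   were transcendental over K(t), there would be a derivation D of K((t)) over
   K(t) with D G_jm <> 0; extend it to Frac K[u][[t]] with D u = 0. As D is not
   continuous, it need not preserve K[u][[t]], but D H turns out to have a
   denominator in K[[t]]: compare H with its remainder modulo w^2, where w in
   K[[t]][u], with invertible leading coefficient, is a multiple of the Jacobian
   determinant obtained by Weierstrass division.
   After clearing denominators D F is therefore a solution in K[u][[t]] of the
   linearized system, which has only the zero solution, so D G_jm = 0. Thus
   all G_jm are algebraic over K(t); then every derivation of Frac K[u][[t]] over
   K(t, u) kills G, hence H because the Jacobian is invertible, hence F. *)

Set Implicit Arguments.
Unset Strict Implicit.
Unset Printing Implicit Defensive.

Import GRing.Theory.
Local Open Scope ring_scope.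

(** * Extension of derivations *)

(** The values lie in [S], an [R]-module through [tau]: below, [R] is K[u][[t]] and [S] its fraction
    field, or [tau] is the identity of a field. *)
Definition derivation_along (R S : pzRingType) (tau d : R -> S) : Prop :=
  (forall x y, d (x + y) = d x + d y) /\
  (forall x y, d (x * y) = d x * tau y + tau x * d y).

Section DerivationTheory.
Variables (R S : comNzRingType) (tau : {rmorphism R -> S}) (d : R -> S).
Hypothesis der : derivation_along tau d.

Lemma derivation_along0 : d 0 = 0.
Proof. by apply: (addrI (d 0)); rewrite -der.1 !addr0. Qed.

Lemma derivation_along1 : d 1 = 0.
Proof.
apply: (addrI (d 1)).
by rewrite addr0 -{3}[1]mulr1 der.2 rmorph1 mulr1 mul1r.
Qed.

Lemma derivation_alongN x : d (- x) = - d x.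
Proof. by apply: (addrI (d x)); rewrite -der.1 !subrr derivation_along0. Qed.

Lemma derivation_alongB x y : d (x - y) = d x - d y.
Proof. by rewrite der.1 derivation_alongN. Qed.

Lemma derivation_along_sum (I : Type) (r : seq I) (P : pred I) (F : I -> R) :
  d (\sum_(i <- r | P i) F i) = \sum_(i <- r | P i) d (F i).
Proof. exact: (big_morph d der.1 derivation_along0). Qed.

End DerivationTheory.

Lemma derivation_comp (R S : pzRingType) (tau : {rmorphism R -> S}) (D : S -> S) :
  derivation_along idfun D -> derivation_along tau (fun x => D (tau x)).
Proof. by move=> der; split=> x y; rewrite (rmorphD, rmorphM) (der.1, der.2). Qed.

Section PartialDerivation.
Variable E : fieldType.
Implicit Types (T : set (E * E)) (x y z : E).

(* the graph of a partial derivation is a subring of the dual numbers over E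
   on which the first projection is injective *)
Record dual_subring T : Prop := DualSubring {
  dual1 : T (1, 0);
  dualB : forall x x' y y', T (x, x') -> T (y, y') -> T (x - y, x' - y');
  dualM : forall x x' y y', T (x, x') -> T (y, y') ->
            T (x * y, x' * y + x * y') }.

Definition partial_derivation T :=
  dual_subring T /\ forall z, T (0, z) -> z = 0.

(** In dual numbers, with e^2 = 0, these are the values of q + e q' at x + e z: for a subring [T],
    the subring generated by [T] and x + e z. Here [q'] is an independent polynomial, not the
    derivative of [q]. *)
Definition dual_adjoin T x z : set (E * E) := fun p =>
  exists q q' : {poly E}, (forall i, T (q`_i, q'`_i)) /\
    p = (q.[x], q'.[x] + q^`().[x] * z).

Section DualSubring.
Variables (T : set (E * E)) (Tr : dual_subring T).

Lemma dual0 : T (0, 0).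
Proof. by have := dualB Tr (dual1 Tr) (dual1 Tr); rewrite !subrr. Qed.

Lemma dualN x x' : T (x, x') -> T (- x, - x').
Proof. by move=> Tx; have := dualB Tr dual0 Tx; rewrite !sub0r. Qed.

Lemma dualD x x' y y' : T (x, x') -> T (y, y') -> T (x + y, x' + y').
Proof.
by move=> Tx Ty; have := dualB Tr Tx (dualN Ty); rewrite !opprK.
Qed.

Lemma dual_sum n (f g : nat -> E) : (forall i, T (f i, g i)) ->
  T (\sum_(i < n) f i, \sum_(i < n) g i).
Proof.
move=> fg; elim: n => [|n IH]; first by rewrite !big_ord0; apply: dual0.
by rewrite !big_ord_recr; apply: dualD.
Qed.

Lemma dualMn x x' n : T (x, x') -> T (x *+ n, x' *+ n).
Proof.
move=> Tx; elim: n => [|n IH]; first by rewrite !mulr0n; apply: dual0.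
by rewrite !mulrSr; apply: dualD.
Qed.

Lemma dual_adjoin_subring x z : dual_subring (dual_adjoin T x z).
Proof.
split.
- exists 1, 0; split.
    by move=> i; rewrite coef0 coef1; case: i => [|i] /=;
      [apply: dual1|apply: dual0].
  by rewrite derivC !hornerE.
- move=> y1 y1' y2 y2' [p [p' [pT [-> ->]]]] [q [q' [qT [-> ->]]]].
  exists (p - q), (p' - q'); split.
    by move=> i; rewrite !coefB; apply: dualB.
  by rewrite derivB !hornerD !hornerN; congr pair; ring.
- move=> y1 y1' y2 y2' [p [p' [pT [-> ->]]]] [q [q' [qT [-> ->]]]].
  exists (p * q), (p' * q + p * q'); split.
    move=> i; rewrite coefD !coefM -big_split.
    have := @dual_sum i.+1 (fun j => p`_j * q`_(i - j))
      (fun j => p'`_j * q`_(i - j) + p`_j * q'`_(i - j)) _.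
    by apply=> j; apply: dualM.
  by rewrite derivM !(hornerD, hornerM); congr pair; ring.
Qed.

Lemma dual_adjoin_sub x z : (T `<=` dual_adjoin T x z)%classic.
Proof.
move=> [y y'] Ty; exists y%:P, y'%:P; split.
  by move=> i; rewrite !coefC; case: eqP => // _; apply: dual0.
by rewrite derivC !hornerE.
Qed.

Lemma dual_adjoin_gen x z : dual_adjoin T x z (x, z).
Proof.
exists 'X, 0; split.
  move=> i; rewrite coefX coef0.
  by case: eqP => _; [apply: dual1|apply: dual0].
by rewrite hornerX horner0 derivX hornerC mul1r add0r.
Qed.

End DualSubring.

Section Extension.
Hypothesis charE : [pchar E] =i pred0.

(** If no nonzero polynomial over the domain of [T] vanishes at [x], any [z] is consistent and 0
    will do. Otherwise a vanishing polynomial [q0] of least degree forces [z], and pseudo-division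
    by [q0], the domain being only a ring, shows consistency. *)
Lemma partial_derivation_adjoin T x : partial_derivation T ->
  exists z, partial_derivation (dual_adjoin T x z).
Proof.
move=> [Tr Tfun].
pose vanish n := `[< exists q q' : {poly E}, [/\ forall i, T (q`_i, q'`_i),
   q != 0, q.[x] = 0 & size q = n] >].
have [[n vn]|novan] := pselect (exists n, vanish n); last first.
  exists 0; split; first exact: dual_adjoin_subring.
  move=> z [q [q' [Tq [q0 ->]]]].
  have q_eq0 : q = 0.
    apply/eqP/negPn/negP => qn0; apply: novan; exists (size q).
    by apply/asboolP; exists q, q'; split.
  have -> : q' = 0.
    by apply/polyP => i; have := Tq i; rewrite q_eq0 !coef0 => /Tfun.
  by rewrite horner0 mulr0 addr0.
have exn : exists n, vanish n by exists n.
case: (ex_minnP exn) => m /asboolP[q0 [q0' [Tq0 q0n q0x q0m]]] mmin {n vn exn}.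
have minq (r r' : {poly E}) : (forall i, T (r`_i, r'`_i)) -> r.[x] = 0 ->
    (size r < m)%N -> r = 0.
  move=> Tr' rx; rewrite ltnNge => /negP sr; apply/eqP/negPn/negP => rn0.
  by apply: sr; apply: mmin; apply/asboolP; exists r, r'; split.
have m1 : (1 < m)%N.
  rewrite ltnNge -q0m; apply/negP => /size1_polyC q0c.
  by move: q0x q0n; rewrite q0c hornerC => ->; rewrite eqxx.
(* The derivative of [q0] is shorter, so it would be zero by minimality; but its coefficient of
   index [m - 2] is [m - 1] times the leading coefficient of [q0], nonzero in characteristic 0. *)
have dq0x : q0^`().[x] != 0.
  apply/eqP => e.
  have : q0^`() = 0.
    apply: (minq _ q0'^`()) => //.
      by move=> i; rewrite !coef_deriv; apply: dualMn.
    by rewrite -q0m lt_size_deriv.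
  move=> /(congr1 (fun p : {poly E} => p`_m.-2)); rewrite coef_deriv coef0.
  rewrite -subn2 -subSn // subn2 /= => /eqP; rewrite -mulr_natr mulf_eq0.
  rewrite -q0m -lead_coefE lead_coef_eq0 (negPf q0n) /= (pcharf0P E).1 //.
  by rewrite q0m; case: (m) m1 => [|[]].
exists (- q0'.[x] / q0^`().[x]); set z := - _ / _.
pose del (q q' : {poly E}) := q'.[x] + q^`().[x] * z.
have del0 : del q0 q0' = 0 by rewrite /del /z mulrCA divff // mulr1 subrr.
split; first exact: dual_adjoin_subring.
suff H n (q q' : {poly E}) : (size q < n)%N -> (forall i, T (q`_i, q'`_i)) ->
    q.[x] = 0 -> del q q' = 0.
  by move=> y [q [q' [Tq [qx ->]]]]; apply: (H (size q).+1).
elim: n q q' => // n IH q q' sq Tq qx.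
have [qm|mq] := ltnP (size q) m.
  have q_eq0 := minq _ _ Tq qx qm.
  have q'_eq0 : q' = 0.
    by apply/polyP => i; have := Tq i; rewrite q_eq0 !coef0 => /Tfun.
  by rewrite /del q_eq0 q'_eq0 deriv0 !horner0 mul0r addr0.
pose c := lead_coef q0; pose c' := q0'`_(size q0).-1.
pose b := lead_coef q; pose b' := q'`_(size q).-1.
have Tc : T (c, c') by apply: Tq0.
have Tb : T (b, b') by apply: Tq.
pose e := (size q - size q0)%N.
(* The leading terms cancel in [r], and the product rule dictates the companion [r']. *)
pose r := c *: q - b *: ('X^e * q0).
pose r' := c' *: q + c *: q' - (b' *: ('X^e * q0) + b *: ('X^e * q0')).
have Tr' i : T (r`_i, r'`_i).
  rewrite !(coefB, coefD, coefZ); apply: dualB => //; apply: dualM => //.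
  by rewrite !coefXnM; case: ifP => _ //; apply: dual0.
have rx : r.[x] = 0.
  by rewrite /r !(hornerE, hornerXn) qx q0x /= !mulr0 subr0.
have sz0 : (0 < size q)%N by apply: leq_trans mq; apply: leq_trans m1.
have sr : (size r < n)%N.
  apply: leq_trans (_ : (size q <= n)%N) => //.
  have rs : (size r <= size q)%N.
    rewrite /r; apply: leq_trans (size_polyD _ _) _; rewrite size_polyN geq_max.
    rewrite (leq_trans (size_scale_leq _ _)) //=.
    rewrite (leq_trans (size_scale_leq _ _)) //=.
    rewrite size_monicM ?monicXn // size_polyXn addSn /= /e q0m.
    by rewrite subnK.
  rewrite ltn_neqAle rs andbT; apply/eqP => srq.
  have : lead_coef r = 0.
    rewrite /lead_coef srq /r coefB !coefZ coefXnM.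
    have -> : ((size q).-1 < e)%N = false.
      apply/negbTE; rewrite -leqNgt /e q0m; move: m1 mq sz0.
      by case: (size q) => // s; case: (m) => // m' _ _ _; rewrite subSS leq_subr.
    have -> : ((size q).-1 - e)%N = (size q0).-1.
      rewrite /e q0m; move: m1 mq sz0.
      case: (size q) => // s; case: (m) => // m' _ mq _.
      by rewrite subSS /= subKn.
    by rewrite -/c -/b /c /b /lead_coef mulrC subrr.
  move/eqP; rewrite lead_coef_eq0 -size_poly_eq0 srq => /eqP sq0.
  by rewrite sq0 in sz0.
have := IH _ _ sr Tr' rx.
have -> : del r r' = c * del q q'.
  transitivity (c * del q q' - b * x ^+ e * del q0 q0'); last first.
    by rewrite del0 mulr0 subr0.
  rewrite /del /r /r' !(derivB, derivZ, derivM, hornerE, hornerXn) qx q0x /=.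
  by ring.
by move/eqP; rewrite mulf_eq0 lead_coef_eq0 (negPf q0n) /= => /eqP.
Qed.

(** By Zorn's lemma some maximal partial derivation contains [T]; by [partial_derivation_adjoin] it
    is defined everywhere. *)
Lemma partial_derivation_extend T : partial_derivation T ->
  exists D : E -> E,
    derivation_along idfun D /\ forall x x', T (x, x') -> D x = x'.
Proof.
move=> pT.
(* The union with [T] makes [P] hold for the union of the empty chain. *)
pose P (X : set (E * E)) := partial_derivation (X `|` T)%classic.
have [A [PA maxA]] : exists A, P A /\ forall B, (A `<` B)%classic -> ~ P B.
  apply: Zorn_bigcup => F FP Ftot.
  have two p q : (\bigcup_(X in F) X `|` T)%classic p ->
      (\bigcup_(X in F) X `|` T)%classic q ->
      exists X, [/\ partial_derivation X, X p, X q &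
        (X `<=` \bigcup_(X in F) X `|` T)%classic].
    have sub X : F X -> (X `|` T `<=` \bigcup_(X in F) X `|` T)%classic.
      by move=> FX y [Xy|Ty]; [left; exists X|right].
    move=> [[X FX Xp]|Tp] [[Y FY Yq]|Tq].
    - have [XY|YX] := Ftot _ _ FX FY.
        exists (Y `|` T)%classic; split; [exact: FP|left; exact: XY|by left|].
        exact: sub.
      exists (X `|` T)%classic; split; [exact: FP|by left|left; exact: YX|].
      exact: sub.
    - exists (X `|` T)%classic; split; [exact: FP|by left|by right|exact: sub].
    - exists (Y `|` T)%classic; split; [exact: FP|by right|by left|exact: sub].
    - by exists T; split => //; right.
  split; first split.
  - by right; apply: dual1 pT.1.
  - move=> x x' y y' hx hy; have [X [[Xr _] Xx Xy sub]] := two _ _ hx hy.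
    by apply: sub; apply: dualB.
  - move=> x x' y y' hx hy; have [X [[Xr _] Xx Xy sub]] := two _ _ hx hy.
    by apply: sub; apply: dualM.
  - move=> z hz; have [X [[_ Xfun] Xz _ _]] := two _ _ hz hz.
    exact: Xfun.
have dom x : exists z, (A `|` T)%classic (x, z).
  have [z pz] := partial_derivation_adjoin x PA.
  exists z; apply: contrapT => nAz.
  pose B := dual_adjoin (A `|` T)%classic x z.
  have AB : (A `|` T `<=` B)%classic by apply: dual_adjoin_sub; apply: PA.1.
  apply: (maxA B).
    split; first by move=> y Ay; apply: AB; left.
    move=> BA; apply: nAz; left; apply: BA.
    exact: dual_adjoin_gen PA.1 x z.
  rewrite /P; have -> // : (B `|` T = B)%classic.
  by apply/seteqP; split => [y [//|Ty]|y By]; [apply: AB; right|left].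
have fun_A x y z : (A `|` T)%classic (x, y) -> (A `|` T)%classic (x, z) -> y = z.
  move=> xy xz; have := dualB PA.1 xy xz; rewrite subrr => /PA.2/eqP.
  by rewrite subr_eq0 => /eqP.
exists (fun x => sval (cid (dom x))); split; first split.
- move=> x y; case: cid => z hz; case: cid => x' hx; case: cid => y' hy /=.
  exact: fun_A hz (dualD PA.1 hx hy).
- move=> x y; case: cid => z hz; case: cid => x' hx; case: cid => y' hy /=.
  exact: fun_A hz (dualM PA.1 hx hy).
- move=> x x' Tx; case: cid => z hz /=.
  by apply: fun_A hz _; right.
Qed.

(** The zero derivation on the image of [k] extends to [x] with value 1, because only the zero
    polynomial over [k] vanishes at [x]; then it extends to [E]. *)
Lemma transcendental_derivation (k : nzRingType) (f : {rmorphism k -> E}) x :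
  ~ (exists2 p : {poly k}, p != 0 & root (map_poly f p) x) ->
  exists D : E -> E, [/\ derivation_along idfun D, forall c, D (f c) = 0
    & D x = 1].
Proof.
move=> trx; pose T0 : set (E * E) := fun p => exists c, p = (f c, 0).
have T0r : dual_subring T0.
  split; first by exists 1; rewrite rmorph1.
    by move=> _ _ _ _ [c [-> ->]] [e [-> ->]]; exists (c - e); rewrite rmorphB subrr.
  move=> _ _ _ _ [c [-> ->]] [e [-> ->]]; exists (c * e).
  by rewrite rmorphM mul0r mulr0 addr0.
have : partial_derivation (dual_adjoin T0 x 1).
  split; first exact: dual_adjoin_subring.
  move=> z [q [q' [Tq [q0 ->]]]].
  have q'0 : q' = 0.
    by apply/polyP => i; have [c [_ ->]] := Tq i; rewrite coef0.
  have /choice[g gq] : forall i, exists c, q`_i = f c.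
    by move=> i; have [c [-> _]] := Tq i; exists c.
  pose p := \poly_(i < size q) g i.
  have qE : q = map_poly f p.
    apply/polyP => i; rewrite coef_map coef_poly; case: ltnP => sq; first exact: gq.
    by rewrite nth_default //= rmorph0.
  have p0 : p = 0.
    apply/eqP/negPn/negP => pn0; apply: trx; exists p => //.
    by rewrite /root -qE -q0.
  by rewrite q'0 qE p0 map_poly0 deriv0 !horner0 mul0r addr0.
move=> /partial_derivation_extend[D [derD DT]]; exists D; split => //.
  by move=> c; apply: DT; apply: dual_adjoin_sub => //; exists c.
by apply: DT; apply: dual_adjoin_gen.
Qed.

(** Differentiating a relation [q(x) = 0] of least degree gives [q'(x) D(x) = 0], where [q'(x)] is
    nonzero by minimality and characteristic 0. *)
Lemma derivation_algebraic (k : idomainType) (f : {rmorphism k -> E})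
    (D : E -> E) x :
  injective f -> derivation_along idfun D -> (forall c, D (f c) = 0) ->
  (exists2 p : {poly k}, p != 0 & root (map_poly f p) x) -> D x = 0.
Proof.
move=> finj der Df [p pn0 px].
have DP (q : {poly k}) : D (map_poly f q).[x] = (map_poly f q)^`().[x] * D x.
  elim/poly_ind: q => [|q c IH].
    by rewrite map_poly0 deriv0 !horner0 mul0r (derivation_along0 der).
  rewrite rmorphD rmorphM /= map_polyX map_polyC /=.
  rewrite derivD derivM derivX derivC !hornerE der.1 der.2 IH Df /=; ring.
have : exists n, `[< exists q : {poly k}, [/\ q != 0, root (map_poly f q) x
     & size q = n] >].
  by exists (size p); apply/asboolP; exists p; split.
move=> exn; case: (ex_minnP exn) => m /asboolP[q [qn0 qx qm]] mmin {exn}.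
have := DP q; rewrite (eqP qx) (derivation_along0 der) => /esym/eqP.
rewrite mulf_eq0 deriv_map => /orP[/eqP e|/eqP //].
have f0 c : f c = 0 -> c = 0 by move=> fc; apply: finj; rewrite fc rmorph0.
have q1 : (1 < m)%N.
  rewrite ltnNge -qm; apply/negP => /size1_polyC qc; move: qx qn0.
  by rewrite qc map_polyC /root hornerC /= => /eqP/f0 ->; rewrite polyC0 eqxx.
case/eqP: qn0; apply/eqP; rewrite -lead_coef_eq0; apply/eqP/f0/eqP.
have q'0 : q^`() = 0.
  apply/eqP/negPn/negP => q'n0.
  have /mmin : `[< exists r : {poly k}, [/\ r != 0, root (map_poly f r) x
     & size r = size q^`()] >].
    by apply/asboolP; exists q^`(); split => //; apply/eqP.
  rewrite -qm leqNgt lt_size_deriv //.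
  by rewrite -size_poly_gt0 qm; apply: leq_trans q1.
move: q'0 => /(congr1 (fun p : {poly k} => f p`_m.-2)).
rewrite coef_deriv coef0 rmorph0 -subn2 -subSn // subn2 /= rmorphMn.
move/eqP; rewrite -mulr_natr mulf_eq0 -qm -lead_coefE => /orP[//|].
by rewrite (pcharf0P E).1 // qm; case: (m) q1 => [|[]].
Qed.

End Extension.
End PartialDerivation.

(** * Power series over a polynomial ring *)

Section Agreement.
Variable R : comNzRingType.
Implicit Types F G H : {pseries R}.

Definition agree m F G := forall i, (i < m)%N -> pscoef F i = pscoef G i.

Lemma agreeD m F F' G G' :
  agree m F F' -> agree m G G' -> agree m (F + G) (F' + G').
Proof. by move=> FF GG i im; rewrite !pscoefD FF ?GG. Qed.

Lemma agreeM m F F' G G' :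
  agree m F F' -> agree m G G' -> agree m (F * G) (F' * G').
Proof.
move=> FF GG i im; rewrite !pscoefM; apply: eq_bigr => j _.
by rewrite FF ?GG //; [apply: leq_ltn_trans (leq_subr _ _) im |
  apply: leq_ltn_trans im; rewrite -ltnS].
Qed.

Lemma agreeM_small m F G H : pscoef H 0 = 0 ->
  agree m F G -> agree m.+1 (H * F) (H * G).
Proof.
move=> H0 FG i im; rewrite !pscoefM !big_ord_recl H0 !mul0r !add0r.
apply: eq_bigr => j _; rewrite FG //= /bump.
by have := ltn_ord j; lia.
Qed.

(** The iterates of [Phi] from 0 stabilize: the m-th one is final modulo t^m. The fixed point takes
    its coefficient of t^m from iterate [m + 1]. *)
Lemma contraction_fixpoint (I : Type)
    (Phi : (I -> {pseries R}) -> I -> {pseries R}) :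
  (forall m (F G : I -> {pseries R}), (forall i, agree m (F i) (G i)) ->
     forall i, agree m.+1 (Phi F i) (Phi G i)) ->
  exists F : I -> {pseries R}, forall i, F i = Phi F i.
Proof.
move=> ctr; pose it m := iter m Phi (fun=> 0).
have itE m p i : agree m (it m i) (it (m + p)%N i).
  elim: m p i => // m IH p i; rewrite addSn /it !iterS; apply: ctr => j.
  exact: IH.
pose F i := PSeries (fun m => pscoef (it m.+1 i) m).
have FE m i : agree m (F i) (it m i).
  move=> j jm /=; rewrite (itE j.+1 (m - j.+1)%N i j (ltnSn j)).
  by rewrite subnKC.
exists F => i; apply: pseriesP => m.
rewrite (FE m.+1 i m (ltnSn m)) /it iterS; apply/esym.
exact: (ctr m F (it m) (FE m) i m (ltnSn m)).
Qed.

Lemma contraction_unique (I : Type)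
    (Phi : (I -> {pseries R}) -> I -> {pseries R}) :
  (forall m (F G : I -> {pseries R}), (forall i, agree m (F i) (G i)) ->
     forall i, agree m.+1 (Phi F i) (Phi G i)) ->
  forall F G : I -> {pseries R}, (forall i, F i = Phi F i) -> (forall i, G i = Phi G i) ->
  forall i, F i = G i.
Proof.
move=> ctr F G FE GE i; apply: pseriesP => m.
suff H j : agree m.+1 (F j) (G j) by apply: H.
by elim: m.+1 j => // p IH j; rewrite FE GE; apply: ctr.
Qed.

End Agreement.

(** * Weierstrass division and the subring K[[t]][u] *)

Section Weierstrass.
Variable K : fieldType.
Local Notation A := {pseries {poly K}}.
Implicit Types (F G H g w : A) (p : {poly K}).

Lemma pscoef_inuM p F m : pscoef (ps_inu p * F) m = p * pscoef F m.
Proof.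
rewrite pscoefM big_ord_recl big1 ?addr0 => [|i _].
  by rewrite /= coefC subn0.
by rewrite /= coefC mul0r.
Qed.

Lemma weierstrass_division g F : pscoef g 0 != 0 ->
  exists q r : A, F = q * g + r /\
    forall m, (size (pscoef r m) < size (pscoef g 0))%N.
Proof.
(* q is the fixed point of q = (F - (g - g_0) q) %/ g_0 *)
move=> g0; pose h := g - ps_inu (pscoef g 0).
pose Phi (q : unit -> A) (i : unit) : A :=
  PSeries (fun m => pscoef (F - h * q i) m %/ pscoef g 0).
have [q qE] : exists q, forall i, q i = Phi q i.
  apply: contraction_fixpoint => m q q' qq i j jm /=.
  change (pscoef (F - h * q i) j %/ pscoef g 0 =
          pscoef (F - h * q' i) j %/ pscoef g 0).
  rewrite !pscoefB (agreeM_small _ (qq i)) //.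
  by rewrite /h /= coefC subrr.
pose W := F - h * q tt.
have qW m : pscoef (q tt) m = pscoef W m %/ pscoef g 0.
  by rewrite {1}(qE tt).
exists (q tt), (W - ps_inu (pscoef g 0) * q tt); split.
  by rewrite /W /h; ring.
move=> m; rewrite pscoefB pscoef_inuM qW.
have -> : pscoef W m - pscoef g 0 * (pscoef W m %/ pscoef g 0) =
   pscoef W m %% pscoef g 0.
  by rewrite {1}(divp_eq (pscoef W m) (pscoef g 0)) mulrC addrAC subrr add0r.
exact: ltn_modpN0.
Qed.

(* w is in K[[t]][u], with leading coefficient a unit of K[[t]] *)
Definition distinguished w :=
  pscoef w 0 != 0 /\ forall m, (size (pscoef w m) <= size (pscoef w 0))%N.

(** Divide g_0 = [pscoef g 0] by [g]: modulo t the remainder is a multiple of g_0 of smaller degree,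
    hence 0. So [w = q g = g_0 - r] has constant coefficient g_0 in t, and its other coefficients
    have smaller degree. *)
Lemma distinguished_multiple g : pscoef g 0 != 0 ->
  exists q w : A, w = q * g /\ distinguished w.
Proof.
move=> g0; have [q [r [E rs]]] := weierstrass_division (ps_inu (pscoef g 0)) g0.
have r0 : pscoef r 0 = 0.
  have := congr1 (fun F : A => pscoef F 0) E.
  rewrite pscoefD pscoefM big_ord1 subnn /= => e.
  have e' : r.(pscoef) 0 = (1 - pscoef q 0) * pscoef g 0.
    by move: e; rewrite coefC eqxx mulrBl mul1r => {1}->; rewrite addrC addKr.
  have := rs 0%N; rewrite e'; have [->|n0] := eqVneq (1 - pscoef q 0) 0.
    by rewrite mul0r.
  rewrite size_mul // => lt; exfalso; move: n0; rewrite -size_poly_gt0 => n0.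
  by move: n0 lt; case: (size _) => [//|s] _; rewrite addSn ltnNge leq_addl.
exists q, (ps_inu (pscoef g 0) - r); split; first by rewrite {1}E addrK.
have w0 : pscoef (ps_inu (pscoef g 0) - r) 0 = pscoef g 0.
  by rewrite pscoefB r0 subr0 /= coefC.
split; rewrite w0 // => m.
apply: leq_trans (size_polyD _ _) _; rewrite size_polyN geq_max (ltnW (rs m)) andbT.
by rewrite /= coefC; case: ifP => // _; rewrite size_poly0.
Qed.

(* the subring K[[t]][u] of K[u][[t]] *)
Definition bounded F := exists N, forall m, (size (pscoef F m) <= N)%N.

Lemma boundedD F G : bounded F -> bounded G -> bounded (F + G).
Proof.
move=> [M FM] [N GN]; exists (maxn M N) => m.
by rewrite (leq_trans (size_polyD _ _)) // geq_max !leq_max FM GN orbT.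
Qed.

Lemma boundedN F : bounded F -> bounded (- F).
Proof. by move=> [M FM]; exists M => m; rewrite pscoefN size_polyN. Qed.

Lemma boundedM F G : bounded F -> bounded G -> bounded (F * G).
Proof.
move=> [M FM] [N GN]; exists (M + N)%N => m; rewrite pscoefM.
apply: leq_trans (size_sum _ _ _) _; apply/bigmax_leqP => i _.
apply: leq_trans (size_polyMleq _ _) _; apply: leq_trans (leq_pred _) _.
exact: leq_add.
Qed.

Lemma bounded_poly (P : {poly {poly K}}) : bounded (ps_of_poly P).
Proof.
exists (\max_(i < size P) size (P`_i)%R) => m /=.
have [mP|Pm] := ltnP m (size P); last by rewrite nth_default // size_poly0.
exact: (@leq_bigmax _ (fun i : 'I_(size P) => size (P`_i)%R) (Ordinal mP)).
Qed.

(** The coefficient of t^m in [w F] is w_0 F_m plus terms in earlier coefficients of [F]. As no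
    coefficient of [w] exceeds w_0 in degree, the degrees of the F_m do not build up. *)
Lemma bounded_div w F : distinguished w -> bounded (w * F) -> bounded F.
Proof.
move=> [w0 ws] [N wFN].
pose M := (N.+1 + size (pscoef w 0))%N; exists M.
suff H m : (size (pscoef F m) + size (pscoef w 0) <= M)%N.
  by move=> m; apply: leq_trans (leq_addr _ _) (H m).
elim/ltn_ind: m => m IH.
have [->|Fm] := eqVneq (pscoef F m) 0.
  by rewrite size_poly0 add0n leq_addl.
have e : pscoef w 0 * pscoef F m = pscoef (w * F) m -
    \sum_(i < m) pscoef w (i.+1) * pscoef F (m - i.+1).
  by rewrite pscoefM big_ord_recl subn0 addrK.
suff s : (size (pscoef w 0 * pscoef F m)%R < M)%N.
  move: s; rewrite size_mul // addnC.
  by move: Fm; rewrite -size_poly_gt0; case: (size _).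
rewrite e (leq_ltn_trans (size_polyD _ _)) // gtn_max size_polyN.
rewrite (leq_ltn_trans (wFN m)) ?leq_addr //=.
rewrite (leq_ltn_trans (size_sum _ _ _)) // ltnS.
apply/bigmax_leqP => i _; rewrite (leq_trans (size_polyMleq _ _)) //.
have arith x y z : (x <= z -> y + z <= N.+1 + z -> (x + y).-1 <= N + z)%N by lia.
apply: arith (ws i.+1) (IH (m - i.+1)%N _).
by rewrite subnSK // leq_subr.
Qed.

Lemma distinguishedM w w' :
  distinguished w -> distinguished w' -> distinguished (w * w').
Proof.
move=> [w0 ws] [w'0 w's].
have e : pscoef (w * w') 0 = pscoef w 0 * pscoef w' 0.
  by rewrite pscoefM big_ord1.
split; rewrite e ?mulf_neq0 // => m.
rewrite pscoefM (leq_trans (size_sum _ _ _)) //; apply/bigmax_leqP => i _.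
rewrite (leq_trans (size_polyMleq _ _)) // size_mul //.
by rewrite -!subn1 leq_sub2r // leq_add.
Qed.

Lemma distinguished_bounded w : distinguished w -> bounded w.
Proof. by move=> [_ ws]; exists (size (pscoef w 0)). Qed.

End Weierstrass.

(** * Series constant in u, and division by u - a *)

Section Constants.
Variable K : fieldType.
Local Notation A := {pseries {poly K}}.

(* K[[t]] -> K[u][[t]] *)
Definition ps_cst (c : {pseries K}) : A := PSeries (fun m => (pscoef c m)%:P).

Fact ps_cst_zmod_morphism : zmod_morphism ps_cst.
Proof. by move=> c d; apply: pseriesP => m /=; rewrite polyCB. Qed.
Fact ps_cst_monoid_morphism : monoid_morphism ps_cst.
Proof.
split=> [|c d]; apply: pseriesP => m /=.
  by rewrite !coef1; case: eqP.
rewrite rmorph_sum; apply: eq_bigr => i _; exact: polyCM.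
Qed.
HB.instance Definition _ := GRing.isZmodMorphism.Build {pseries K} A
  ps_cst ps_cst_zmod_morphism.
HB.instance Definition _ := GRing.isMonoidMorphism.Build {pseries K} A
  ps_cst ps_cst_monoid_morphism.

Lemma ps_cstM : {morph ps_cst : x y / x * y}.
Proof. exact: rmorphM. Qed.

Lemma ps_cst_inj : injective ps_cst.
Proof.
move=> c d cd; apply: pseriesP => m.
exact: polyC_inj (congr1 (fun F : A => pscoef F m) cd).
Qed.

Lemma bounded_cst c : bounded (ps_cst c).
Proof. by exists 1%N => m; rewrite size_polyC_leq1. Qed.

Variable a : K.

Definition ps_evalK (F : A) : {pseries K} := PSeries (fun m => (pscoef F m).[a]).

Definition ps_ua : A := ps_inu ('X - a%:P).

Lemma ps_evalE F : ps_eval a F = ps_cst (ps_evalK F).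
Proof. by []. Qed.

Lemma Delta_decomp F : F = ps_cst (ps_evalK F) + ps_ua * Delta a F.
Proof. by rewrite DeltaP ps_evalE addrC subrK. Qed.

Lemma ps_ua_neq0 : ps_ua != 0.
Proof.
apply/eqP => /(congr1 (fun F : A => pscoef F 0)) /=; rewrite coefC eqxx.
by move/eqP; rewrite polyXsubC_eq0.
Qed.

Lemma ps_evalK_add c F : ps_evalK (ps_cst c + ps_ua * F) = c.
Proof.
apply: pseriesP => m.
change ((pscoef (ps_cst c) m + pscoef (ps_ua * F) m).[a] = pscoef c m).
rewrite pscoef_inuM.
by rewrite !hornerE subrr mul0r addr0.
Qed.

Lemma Delta_add c F : Delta a (ps_cst c + ps_ua * F) = F.
Proof.
apply: (mulfI ps_ua_neq0); apply: (addrI (ps_cst c)).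
by rewrite -{1}(ps_evalK_add c F) -Delta_decomp.
Qed.

Lemma agree_Delta m F G : agree m F G -> agree m (Delta a F) (Delta a G).
Proof. by move=> FG i im /=; rewrite FG. Qed.

Lemma iter_Delta0 m : iter m (Delta a) (0 : A) = 0.
Proof.
elim: m => //= m ->; apply: pseriesP => m' /=.
by rewrite horner0 subrr div0p.
Qed.

End Constants.

(** * Polynomial expressions in the iterates of Delta *)

(** One proof for three uses: congruence modulo t^m, congruence modulo [w] and, with a relation that
    ignores its second argument, boundedness. *)
Lemma mmap_rel (m : nat) (k : nzRingType) (R : comNzRingType)
    (phi : {rmorphism k -> R}) (E : R -> R -> Prop) (x y : 'I_m -> R)
    (Q : {mpoly k[m]}) :
  (forall c, E (phi c) (phi c)) ->
  (forall u u' v v', E u u' -> E v v' -> E (u + v) (u' + v')) ->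
  (forall u u' v v', E u u' -> E v v' -> E (u * v) (u' * v')) ->
  (forall i, E (x i) (y i)) -> E (mmap phi x Q) (mmap phi y Q).
Proof.
move=> Ec ED EM Exy.
have E0 : E 0 0 by rewrite -(rmorph0 phi).
have E1 : E 1 1 by rewrite -(rmorph1 phi).
rewrite /mmap; apply: (big_ind2 E); [by []|by []|move=> mon _; apply: (EM _ _ _ _ (Ec _))].
rewrite /mmap1; apply: (big_ind2 E); [by []|by []|move=> i _].
by elim: (mon i) => [|e IH]; rewrite ?expr0 // !exprS; apply: EM.
Qed.

(** Chain rule. The polynomials satisfying it contain the constants and the variables and are closed
    under sums and products. *)
Lemma mmap_derivation (m : nat) (k : comNzRingType) (R S : comNzRingType)
    (phi : {rmorphism k -> R}) (tau : {rmorphism R -> S}) (d : R -> S)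
    (x : 'I_m -> R) (Q : {mpoly k[m]}) :
  derivation_along tau d -> (forall c, d (phi c) = 0) ->
  d (mmap phi x Q) = \sum_(i < m) tau (mmap phi x (Q^`M(i))) * d (x i).
Proof.
move=> der dphi.
pose P (q : {mpoly k[m]}) :=
  d (mmap phi x q) = \sum_(i < m) tau (mmap phi x (q^`M(i))) * d (x i).
have PC c : P c%:MP.
  rewrite /P mmapC dphi big1 // => i _.
  by rewrite mderivC raddf0 rmorph0 mul0r.
have P1 : P 1 by rewrite -mpolyC1.
have PD p q : P p -> P q -> P (p + q).
  rewrite /P => Pp Pq; rewrite raddfD /= der.1 Pp Pq -big_split /=.
  by apply: eq_bigr => i _; rewrite mderivD raddfD rmorphD mulrDl.
have PM p q : P p -> P q -> P (p * q).
  rewrite /P => Pp Pq; rewrite rmorphM /= der.2 Pp Pq mulr_suml mulr_sumr.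
  rewrite -big_split /=; apply: eq_bigr => i _.
  by rewrite mderivM rmorphD !rmorphM rmorphD !rmorphM /=; ring.
have PX i : P 'X_i.
  rewrite /P mmapX mmap1U (bigD1 i) //= big1 ?addr0 => [|j ji].
    rewrite mderivX mnm1E eqxx scale1r -{1}[U_(i)%MM]add0m addmK mpolyX0.
    by rewrite !rmorph1 mul1r.
  by rewrite mderivX mnm1E eq_sym (negPf ji) scale0r raddf0 rmorph0 mul0r.
apply: (mpolyind (P := P)) => [|c mon p _ _ Pp]; first by rewrite -mpolyC0.
apply: (PD) Pp; rewrite -mul_mpolyC; apply: (PM) => //.
rewrite mpolyXE_id; apply: (big_ind P) => // i _.
by elim: (mon i) => [//|e IH]; rewrite exprS; apply: PM.
Qed.

Lemma sum_mxvec_index (R : comNzRingType) (m p : nat) (f : 'I_(m * p) -> R) :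
  \sum_(i < m * p) f i = \sum_(j < m) \sum_(l < p) f (mxvec_index j l).
Proof.
rewrite pair_bigA (reindex _ (curry_mxvec_bij m p)) /=.
by apply: eq_bigr => -[j l] _.
Qed.

Section Tower.
Variable R : comNzRingType.

(* sum_(i < m) g (m - 1 - i) v^i + h v^m *)
Fixpoint tower (v : R) (g : nat -> R) (h : R) (m : nat) : R :=
  if m is m'.+1 then g m' + v * tower v g h m' else h.

Lemma eq_tower v g g' h m : (forall i, (i < m)%N -> g i = g' i) ->
  tower v g h m = tower v g' h m.
Proof.
elim: m => //= m IH gg; rewrite gg // IH // => i im.
by apply: gg; apply: leqW.
Qed.

Lemma towerB v g h h' m :
  tower v g h m - tower v g h' m = v ^+ m * (h - h').
Proof.
elim: m => [|m IH] /=; first by rewrite expr0 mul1r.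
by rewrite exprS -mulrA -IH; ring.
Qed.

Lemma tower0 v h m : tower v (fun=> 0) h m = v ^+ m * h.
Proof.
elim: m => [|m IH] /=; first by rewrite expr0 mul1r.
by rewrite IH add0r exprS mulrA.
Qed.

Lemma tower_scale c v g h m :
  c * tower v g h m = tower v (fun i => c * g i) (c * h) m.
Proof. by elim: m => //= m <-; ring. Qed.

End Tower.

Lemma rmorph_tower (R S : comNzRingType) (tau : {rmorphism R -> S}) v g h m :
  tau (tower v g h m) = tower (tau v) (fun i => tau (g i)) (tau h) m.
Proof. by elim: m => //= m <-; rewrite rmorphD rmorphM. Qed.

Lemma derivation_tower (R S : comNzRingType) (tau : {rmorphism R -> S})
    (d : R -> S) v g h m : derivation_along tau d -> d v = 0 ->
  d (tower v g h m) = tower (tau v) (fun i => d (g i)) (d h) m.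
Proof.
by move=> der dv; elim: m => //= m <-; rewrite der.1 der.2 dv mul0r add0r.
Qed.

Section DeltaTower.
Variables (K : fieldType) (a : K).
Local Notation A := {pseries {poly K}}.

(** Counting down from [k] lets the tower for Delta^l F use exactly the indices below [k - l]. *)
Definition Delta_const (k : nat) (F : A) (i : nat) : {pseries K} :=
  ps_evalK a (iter (k - i.+1) (Delta a) F).

Lemma iter_Delta_tower k (F : A) m : (m <= k)%N ->
  iter (k - m) (Delta a) F =
  tower (ps_ua a) (fun i => ps_cst (Delta_const k F i)) (iter k (Delta a) F) m.
Proof.
elim: m => [|m IH] mk; first by rewrite subn0.
rewrite /= -IH ?(ltnW mk) // -(subnSK mk) iterS.
exact: Delta_decomp.
Qed.

(** Each [Delta] strips the outermost level of a tower, whatever the constants [g] and the bottom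
    [h]. *)
Lemma iter_Delta_of_tower k (g : nat -> {pseries K}) (h : A) l : (l <= k)%N ->
  iter l (Delta a) (tower (ps_ua a) (fun i => ps_cst (g i)) h k) =
  tower (ps_ua a) (fun i => ps_cst (g i)) h (k - l).
Proof.
elim: l => [|l IH] lk; first by rewrite subn0.
rewrite iterS IH ?(ltnW lk) // -(subnSK lk) /=.
exact: Delta_add.
Qed.

Lemma Delta_const_of_tower k (g : nat -> {pseries K}) (h : A) i : (i < k)%N ->
  Delta_const k (tower (ps_ua a) (fun i => ps_cst (g i)) h k) i = g i.
Proof.
move=> ik; rewrite /Delta_const iter_Delta_of_tower ?leq_subr // subKn //=.
exact: ps_evalK_add.
Qed.

End DeltaTower.

(** * The right-hand sides of the system and their partial derivatives *)

Section System.
Variables (K : fieldType) (n k : nat) (a : K).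
Variables (f : 'I_n -> {poly K}) (Q : 'I_n -> {mpoly K[n * k.+1 + 2]}).
Local Notation A := {pseries {poly K}}.
Implicit Type y : 'I_n -> 'I_k.+1 -> A.

Definition ps_scalar (c : K) : A := ps_inu c%:P.

Fact ps_scalar_zmod_morphism : zmod_morphism ps_scalar.
Proof. by move=> c d; rewrite /ps_scalar /ps_inu !raddfB. Qed.
Fact ps_scalar_monoid_morphism : monoid_morphism ps_scalar.
Proof.
by split=> [|c d]; rewrite /ps_scalar /ps_inu ?rmorph1 ?rmorphM.
Qed.
HB.instance Definition _ := GRing.isZmodMorphism.Build K A
  ps_scalar ps_scalar_zmod_morphism.
HB.instance Definition _ := GRing.isMonoidMorphism.Build K A
  ps_scalar ps_scalar_monoid_morphism.

Definition eval_point y (i : 'I_(n * k.+1 + 2)) : A :=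
  row_mx (mxvec (\matrix_(j, l) y j l))
    (\row_(j < 2) if j == 0 then ps_t K else ps_inu 'X) 0 i.

Definition rhs i y : A :=
  ps_inu (f i) + ps_t K * mmap ps_scalar (eval_point y) (Q i).

(** Partial derivative of [rhs i] in the variable for Delta^l F_j; [lshift 2] places it before the
    variables t and u. *)
Definition drhs i y (j : 'I_n) (l : 'I_k.+1) : A :=
  ps_t K * mmap ps_scalar (eval_point y) ((Q i)^`M(lshift 2 (mxvec_index j l))).

Lemma system_rhsE (F : {ffun 'I_n -> A}) i :
  system_rhs a (f i) (Q i) F = rhs i (fun j l => iter l (Delta a) (F j)).
Proof.
have e : \matrix_(j < n) nabla a k (F j) =
    \matrix_(j, l) iter l (Delta a) (F j).
  by apply/matrixP => j l; rewrite !mxE.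
by rewrite /system_rhs /system_point e.
Qed.

Lemma eval_point_rel (E : A -> A -> Prop) y y' :
  E (ps_t K) (ps_t K) -> E (ps_inu 'X) (ps_inu 'X) ->
  (forall j l, E (y j l) (y' j l)) -> forall i, E (eval_point y i) (eval_point y' i).
Proof.
move=> Et Eu Ey i; rewrite /eval_point; case: (split_ordP i) => i' ->.
  rewrite !row_mxEl; case/mxvec_indexP: i' => j l.
  by rewrite !mxvecE !mxE.
by rewrite !row_mxEr !mxE; case: eqP.
Qed.

(** The factor t gains one order, which makes the system a contraction. *)
Lemma agree_rhs m y y' i : (forall j l, agree m (y j l) (y' j l)) ->
  agree m.+1 (rhs i y) (rhs i y').
Proof.
move=> yy; apply: agreeD; first by [].
apply: agreeM_small; first by rewrite /= coefX.
apply: (mmap_rel (E := agree m)) => [//|||].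
- exact: agreeD.
- exact: agreeM.
- exact: eval_point_rel.
Qed.

Lemma agree_sub_drhs m y i (X X' : 'I_n -> 'I_k.+1 -> A) :
  (forall j l, agree m (X j l) (X' j l)) ->
  agree m.+1 (\sum_j \sum_l drhs i y j l * X j l)
             (\sum_j \sum_l drhs i y j l * X' j l).
Proof.
move=> XX; apply: (big_ind2 (agree m.+1)) => //; first exact: agreeD.
move=> j _; apply: (big_ind2 (agree m.+1)) => //; first exact: agreeD.
move=> l _; rewrite /drhs -!mulrA; apply: agreeM_small.
  by rewrite /= coefX.
exact: agreeM.
Qed.

Lemma drhs_small y i j l : pscoef (drhs i y j l) 0 = 0.
Proof. by rewrite pscoefM big_ord1 /= coefX mul0r. Qed.

Lemma bounded_rhs y i : (forall j l, bounded (y j l)) -> bounded (rhs i y).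
Proof.
move=> yb; apply: boundedD; first exact: bounded_poly.
apply: boundedM; first exact: bounded_poly.
apply: (mmap_rel (E := fun x _ => bounded x) (y := eval_point y)).
- by move=> c; apply: bounded_poly.
- by move=> u _ v _; apply: boundedD.
- by move=> u _ v _; apply: boundedM.
apply: (@eval_point_rel (fun x _ => bounded x) y y) => //; apply: bounded_poly.
Qed.

Definition congr_mod (w x x' : A) := exists v, x - x' = w * v.

Section CongrMod.
Variable w : A.

Lemma congr_mod_refl x : congr_mod w x x.
Proof. by exists 0; rewrite subrr mulr0. Qed.

Lemma congr_modD (x x' z z' : A) : congr_mod w x x' -> congr_mod w z z' ->
  congr_mod w (x + z) (x' + z').
Proof.
by move=> [u e] [v e']; exists (u + v); rewrite mulrDr -e -e'; ring.
Qed.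

Lemma congr_modM (x x' z z' : A) : congr_mod w x x' -> congr_mod w z z' ->
  congr_mod w (x * z) (x' * z').
Proof.
move=> [u e] [v e']; exists (u * z + x' * v).
transitivity ((x - x') * z + x' * (z - z')); first by ring.
by rewrite e e'; ring.
Qed.

Lemma congr_mod_mmap y y' (p : {mpoly K[n * k.+1 + 2]}) :
  (forall j l, congr_mod w (y j l) (y' j l)) ->
  congr_mod w (mmap ps_scalar (eval_point y) p)
    (mmap ps_scalar (eval_point y') p).
Proof.
move=> yy; apply: mmap_rel => [c|||].
- exact: congr_mod_refl.
- exact: congr_modD.
- exact: congr_modM.
by apply: eval_point_rel => //; apply: congr_mod_refl.
Qed.

Lemma congr_mod_rhs y y' i : (forall j l, congr_mod w (y j l) (y' j l)) ->
  congr_mod w (rhs i y) (rhs i y').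
Proof.
move=> yy; apply: congr_modD; first exact: congr_mod_refl.
by apply: congr_modM; [apply: congr_mod_refl|apply: congr_mod_mmap].
Qed.

Lemma congr_mod_drhs y y' i j l :
  (forall j l, congr_mod w (y j l) (y' j l)) ->
  congr_mod w (drhs i y j l) (drhs i y' j l).
Proof.
by move=> yy; apply: congr_modM; [apply: congr_mod_refl|apply: congr_mod_mmap].
Qed.

End CongrMod.

(** As [d] kills t and K[u], the chain rule leaves only the variables for the iterates of
    [Delta]. *)
Lemma derivation_rhs (S : comNzRingType) (tau : {rmorphism A -> S})
    (d : A -> S) y i :
  derivation_along tau d -> d (ps_t K) = 0 -> (forall p, d (ps_inu p) = 0) ->
  d (rhs i y) = \sum_j \sum_l tau (drhs i y j l) * d (y j l).
Proof.
move=> der dt du; rewrite /rhs der.1 du add0r der.2 dt mul0r add0r.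
rewrite (mmap_derivation _ _ der) => [|c]; last exact: du.
rewrite big_split_ord /= [X in _ * (_ + X)]big1 => [|j _]; last first.
  rewrite {2}/eval_point row_mxEr mxE; case: ifP => _.
    by rewrite dt mulr0.
  by rewrite du mulr0.
rewrite addr0 sum_mxvec_index mulr_sumr; apply: eq_bigr => j _.
rewrite mulr_sumr; apply: eq_bigr => l _.
by rewrite {2}/eval_point row_mxEl mxvecE mxE mulrA -rmorphM.
Qed.

End System.

(** * Derivations along a solution *)

(** One term of the sums in [J_dB]: [p] and [q] are a partial derivative at [H] and at [R], while
    [x] and [y] are [d (Y R j l)] and [d (Y H j l)]. *)
Lemma product_increment (R : comNzRingType) (p q x y : R) :
  - (p * y) - p * (x - y) = - (q * x) + (q - p) * x.
Proof. ring. Qed.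

(** The derivative of [w^2 x] keeps a factor [w]. *)
Lemma square_derivative (R : comNzRingType) (w w' x x' : R) :
  (w' * w + w * w') * x + w * w * x' = w * ((w' + w') * x + w * x').
Proof. ring. Qed.

Section ConstantDenominators.
Variable K : fieldType.
Local Notation A := {pseries {poly K}}.
Local Notation tau := (@FracField.tofrac A).
Implicit Type z : {fraction A}.

(* membership in the localization of K[u][[t]] at the nonzero elements of
   K[[t]] *)
Definition cst_denom z :=
  exists2 c : {pseries K}, c != 0 & exists b : A, tau (ps_cst c) * z = tau b.

Lemma cst_denom_tofrac (b : A) : cst_denom (tau b).
Proof. by exists 1; rewrite ?oner_neq0 //; exists b; rewrite rmorph1 tofrac1 mul1r. Qed.

Lemma cst_denomD z z' : cst_denom z -> cst_denom z' -> cst_denom (z + z').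
Proof.
move=> [c c0 [b e]] [c' c'0 [b' e']]; exists (c * c'); first exact: mulf_neq0.
exists (ps_cst c' * b + ps_cst c * b').
by rewrite tofracD !tofracM rmorphM tofracM -e -e'; ring.
Qed.

Lemma cst_denomM z z' : cst_denom z -> cst_denom z' -> cst_denom (z * z').
Proof.
move=> [c c0 [b e]] [c' c'0 [b' e']]; exists (c * c'); first exact: mulf_neq0.
by exists (b * b'); rewrite tofracM rmorphM tofracM -e -e'; ring.
Qed.

Lemma cst_denomB z z' : cst_denom z -> cst_denom z' -> cst_denom (z - z').
Proof.
move=> hz hz'; rewrite -[z']mul1r -mulNr; apply: cst_denomD => //.
by apply: cst_denomM => //; rewrite -tofrac1 -tofracN; apply: cst_denom_tofrac.
Qed.

Lemma cst_denom_sum (I : Type) (r : seq I) (P : pred I) (z : I -> {fraction A}) :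
  (forall i, cst_denom (z i)) -> cst_denom (\sum_(i <- r | P i) z i).
Proof.
move=> hz; apply: big_ind => //; last exact: cst_denomD.
by rewrite -tofrac0; apply: cst_denom_tofrac.
Qed.

Lemma common_denominator (I : finType) (P : I -> {pseries K} -> Prop) :
  (forall i c e, P i c -> P i (c * e)) ->
  (forall i, exists2 c, c != 0 & P i c) ->
  exists2 c, c != 0 & forall i, P i c.
Proof.
move=> PM Pex; have /choice[g gP] : forall i, exists c, c != 0 /\ P i c.
  by move=> i; have [c c0 Pc] := Pex i; exists c.
exists (\prod_i g i); first by apply/prodf_neq0 => i _; apply: (gP i).1.
by move=> i; rewrite (bigD1 i) //=; apply: PM; apply: (gP i).2.
Qed.

End ConstantDenominators.

Section BoundedExpansion.
Variable K : fieldType.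
Local Notation A := {pseries {poly K}}.

Lemma ps_inuXn i : ps_inu 'X ^+ i = ps_inu ('X^i : {poly K}).
Proof. by rewrite /ps_inu -rmorphXn -polyC_exp. Qed.

Lemma pscoef_sum (I : Type) (r : seq I) (P : pred I) (F : I -> A) m :
  pscoef (\sum_(i <- r | P i) F i) m = \sum_(i <- r | P i) pscoef (F i) m.
Proof. exact: (big_morph (fun G : A => pscoef G m)). Qed.

Lemma pscoef_expansion N (c : nat -> {pseries K}) m :
  pscoef (\sum_(i < N) ps_cst (c i) * ps_inu 'X ^+ i) m =
  \poly_(i < N) pscoef (c i) m.
Proof.
rewrite pscoef_sum poly_def; apply: eq_bigr => i _.
by rewrite mulrC ps_inuXn pscoef_inuM mulrC mul_polyC.
Qed.

Lemma bounded_expansion (F : A) : bounded F ->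
  exists N (c : nat -> {pseries K}), F = \sum_(i < N) ps_cst (c i) * ps_inu 'X ^+ i.
Proof.
move=> [N FN]; pose c i := PSeries (fun m => (pscoef F m)`_i); exists N, c.
apply: pseriesP => m; rewrite pscoef_expansion; apply/polyP => i.
rewrite coef_poly; case: ltnP => // Ni.
by rewrite nth_default // (leq_trans (FN m)).
Qed.

End BoundedExpansion.

Section CentralArgument.
Variables (K : fieldType) (n k : nat) (a : K).
Variables (f : 'I_n -> {poly K}) (Q : 'I_n -> {mpoly K[n * k.+1 + 2]}).
Local Notation A := {pseries {poly K}}.
Local Notation tau := (@FracField.tofrac A).
Local Notation v := (ps_ua a).

Variable F : 'I_n -> A.
Hypothesis FE : forall i, F i = rhs f Q i (fun j l => iter l (Delta a) (F j)).

(** The constants [G] stay fixed: [Y R] rebuilds the Delta^l F_j from [G] and a candidate [R] for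
    Delta^k F, so [P] is the system as equations in [R], with root [H]. *)
Let H j : A := iter k (Delta a) (F j).
Let G j i : A := ps_cst (Delta_const a k (F j) i).
Let Y (R : 'I_n -> A) (j : 'I_n) (l : 'I_k.+1) : A := tower v (G j) (R j) (k - l).
Let P i R : A := Y R i ord0 - rhs f Q i (Y R).
(** The powers of [v] arise because [Y R j l] depends on [R j] with factor [v^(k - l)]. *)
Let J : 'M[A]_n := \matrix_(i, j) ((i == j)%:R * v ^+ k -
  \sum_l drhs Q i (Y H) j l * v ^+ (k - l)).

Lemma Y_Delta : Y H = fun j l => iter l (Delta a) (F j).
Proof.
apply: funext => j; apply: funext => l; rewrite /Y -iter_Delta_tower ?leq_subr //.
by rewrite subKn // -ltnS.
Qed.

Lemma P_H i : P i H = 0.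
Proof. by rewrite /P Y_Delta -FE subrr. Qed.

Fact coef0_zmod_morphism : zmod_morphism (fun B : A => pscoef B 0).
Proof. by []. Qed.
Fact coef0_monoid_morphism : monoid_morphism (fun B : A => pscoef B 0).
Proof. by split=> [|B C] /=; rewrite ?coef1 // big_ord1. Qed.

(** The partial derivatives of the right-hand sides carry a factor t, so modulo t the matrix [J] is
    [(u - a)^k] times the identity. *)
Lemma det_J_coef0 : pscoef (\det J) 0 != 0.
Proof.
pose c0 : {rmorphism A -> {poly K}} := HB.pack (fun B : A => pscoef B 0)
  (GRing.isZmodMorphism.Build _ _ _ coef0_zmod_morphism)
  (GRing.isMonoidMorphism.Build _ _ _ coef0_monoid_morphism).
have -> : pscoef (\det J) 0 = \det (map_mx c0 J) by rewrite det_map_mx.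
have -> : map_mx c0 J = (('X - a%:P) ^+ k)%:M.
  apply/matrixP => i j; rewrite !mxE rmorphB rmorphM rmorph_nat rmorph_sum.
  rewrite rmorphXn big1 => [|l _].
    by rewrite subr0 /= coefC eqxx; case: eqP => _; rewrite ?mul1r ?mul0r.
  by rewrite rmorphM; have /= -> := drhs_small Q (Y H) i j l; rewrite mul0r.
by rewrite det_scalar !expf_neq0 // polyXsubC_eq0.
Qed.

Lemma det_J_neq0 : \det J != 0.
Proof. by apply: contraNneq det_J_coef0 => ->. Qed.

Lemma bounded_tower_cst (g : nat -> {pseries K}) h m :
  bounded h -> bounded (tower v (fun i => ps_cst (g i)) h m).
Proof.
move=> hb; elim: m => //= m IH; apply: boundedD; first exact: bounded_cst.
by apply: boundedM IH; apply: bounded_poly.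
Qed.

Section Derivation.
Variable d : A -> {fraction A}.
Hypotheses (der : derivation_along tau d) (dt : d (ps_t K) = 0)
  (du : forall p, d (ps_inu p) = 0).

Lemma dP i R : d (P i R) = d (Y R i ord0) -
  \sum_j \sum_l tau (drhs Q i (Y R) j l) * d (Y R j l).
Proof.
by rewrite (derivation_alongB der) (derivation_rhs f Q _ _ der dt du).
Qed.

(** Both towers have the same constants, so their derivatives differ only at the bottom. *)
Lemma dYB R j l : d (Y R j l) - d (Y H j l) =
  tau v ^+ (k - l) * (d (R j) - d (H j)).
Proof.
rewrite !(derivation_tower _ _ _ der (du _)); exact: towerB.
Qed.

Lemma J_apply i (x : 'I_n -> {fraction A}) :
  \sum_j tau (J i j) * x j = tau v ^+ k * x i -
   \sum_j \sum_l tau (drhs Q i (Y H) j l) * (tau v ^+ (k - l) * x j).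
Proof.
transitivity (\sum_j (tau (((i == j)%:R) * v ^+ k) * x j -
     \sum_l tau (drhs Q i (Y H) j l) * (tau v ^+ (k - l) * x j))).
  apply: eq_bigr => j _; rewrite mxE tofracB mulrBl; congr (_ - _).
  rewrite rmorph_sum mulr_suml; apply: eq_bigr => l _.
  by rewrite rmorphM rmorphXn mulrA.
rewrite sumrB; congr (_ - _).
rewrite (bigD1 i) //= big1 ?addr0 => [|j ji].
  by rewrite eqxx mul1r tofracXn.
by rewrite eq_sym (negPf ji) mul0r tofrac0 mul0r.
Qed.

Lemma dPH i : d (Y H i ord0) =
  \sum_j \sum_l tau (drhs Q i (Y H) j l) * d (Y H j l).
Proof.
have : d (P i H) = 0 by rewrite P_H (derivation_along0 der).
by rewrite dP => /eqP; rewrite subr_eq0 => /eqP.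
Qed.

(** By [dYB], [d (Y R) - d (Y H)] involves only the [d (R j) - d (H j)]. Subtracting [dPH] from [dP]
    thus produces [J], up to a correction by the change of the partial derivatives from [H] to
    [R]. *)
Lemma J_dB i R : \sum_j tau (J i j) * (d (R j) - d (H j)) =
  d (P i R) + \sum_j \sum_l
     (tau (drhs Q i (Y R) j l) - tau (drhs Q i (Y H) j l)) * d (Y R j l).
Proof.
have Y0 := dYB R i ord0; rewrite subn0 in Y0.
rewrite dP J_apply -Y0 dPH -!addrA; congr (_ + _).
rewrite -!sumrN -!big_split /=; apply: eq_bigr => j _.
rewrite -!sumrN -!big_split /=; apply: eq_bigr => l _.
rewrite -dYB; exact: product_increment.
Qed.

Lemma cramer (x : 'I_n -> {fraction A}) j :
  tau (\det J) * x j =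
  \sum_i tau ((\adj J) j i) * \sum_j' tau (J i j') * x j'.
Proof.
pose X : 'cV_n := \col_j x j.
have := congr1 (fun M => (map_mx tau M *m X) j 0) (mul_adj_mx J).
rewrite map_mxM -mulmxA map_scalar_mx mul_scalar_mx !mxE => <-.
apply: eq_bigr => i _; rewrite !mxE; congr (_ * _).
by apply: eq_bigr => j' _; rewrite !mxE.
Qed.

(** When [d] kills the constants, [d (Y H)] reduces to multiples of the [d (H j)], and [dPH] becomes
    [J (d H) = 0] with nonzero determinant. *)
Lemma dH_eq0 : (forall j i, (i < k)%N -> d (G j i) = 0) ->
  forall j, d (H j) = 0.
Proof.
move=> dG j.
have dYE i l : d (Y H i l) = tau v ^+ (k - l) * d (H i).
  rewrite (derivation_tower _ _ _ der (du _)) -tower0; apply: eq_tower => m ml.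
  by apply: dG; apply: leq_trans ml (leq_subr _ _).
have Jd i : \sum_j tau (J i j) * d (H j) = 0.
  have Y0 := dYE i ord0; rewrite subn0 in Y0.
  rewrite J_apply -Y0 dPH; apply/eqP; rewrite subr_eq0; apply/eqP; apply: eq_bigr => j' _.
  by apply: eq_bigr => l _; rewrite dYE.
have := cramer (fun j => d (H j)) j.
rewrite big1 => [/eqP|i _]; last by rewrite Jd mulr0.
by rewrite mulf_eq0 tofrac_eq0 (negPf det_J_neq0) => /eqP.
Qed.


Lemma dF_eq0 : (forall j i, (i < k)%N -> d (G j i) = 0) ->
  forall j, d (F j) = 0.
Proof.
move=> dG j.
have <- : Y H j ord0 = F j by rewrite Y_Delta.
rewrite /Y subn0 (derivation_tower _ _ _ der (du _)) dH_eq0 //.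
rewrite (eq_tower _ _ (dG j)) tower0; exact: mulr0.
Qed.

(** That is, [d] maps K[[t]] to its fraction field, not necessarily to K[[t]] itself. *)
Hypothesis dcst : forall c, exists2 e : {pseries K}, e != 0 &
  exists g : {pseries K}, tau (ps_cst e) * d (ps_cst c) = tau (ps_cst g).

(** A bounded series is a finite sum of powers of u, killed by [d], with coefficients in K[[t]], so
    finitely many denominators suffice. *)
Lemma cst_denom_bounded B : bounded B -> cst_denom (d B).
Proof.
move=> /bounded_expansion[N [c ->]]; rewrite (derivation_along_sum der).
apply: cst_denom_sum => i; rewrite der.2 ps_inuXn du mulr0 addr0.
apply: cst_denomM; last exact: cst_denom_tofrac.
by have [e e0 [g ge]] := dcst (c i); exists e => //; exists (ps_cst g).
Qed.

(* J is the Jacobian matrix of P at H. If w is a multiple of det J lying in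
   K[[t]][u], reduce H modulo w^2 to R with coefficients in K[[t]][u]. Then P R
   is w^2 times an element of K[[t]][u], so d (P R) is divisible by w, and so is
   J (dR - dH) = d (P R) - d (P H) modulo w. Cramer's rule divides by det J,
   hence at worst by w. *)
Lemma cst_denom_dH j : cst_denom (d (H j)).
Proof.
have [q [w [wq wD]]] := distinguished_multiple det_J_coef0.
have wwD := distinguishedM wD wD.
have /choice[R HR] : forall j, exists R, bounded R /\
    exists S : A, H j = S * (w * w) + R.
  move=> i; have [S [R [e Rs]]] := weierstrass_division (H i) wwD.1.
  exists R; split; last by exists S.
  by exists (size (pscoef (w * w) 0)) => m; apply: ltnW.
have YR j' l : bounded (Y R j' l).
  by apply: bounded_tower_cst; apply: (HR j').1.
have YRH j' l : congr_mod (w * w) (Y R j' l) (Y H j' l).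
  rewrite /congr_mod towerB; have [S ->] := (HR j').2.
  by exists (- v ^+ (k - l) * S); ring.
have PRT i : exists T, P i R = (w * w) * T /\ bounded T.
  have [T e] : exists T, P i R = (w * w) * T.
    have [T1 e1] := YRH i ord0; have [T2 e2] := congr_mod_rhs f Q i YRH.
    exists (T1 - T2); rewrite mulrBr -e1 -e2 -[LHS]subr0 -(P_H i) /P.
    move: (Y R i ord0) (Y H i ord0) (rhs f Q i (Y R)) (rhs f Q i (Y H)).
    by move=> x x' y y'; ring.
  (* As [w * w] is distinguished, the quotient [T] stays in K[[t]][u], so [d T] has a denominator in
     K[[t]]. *)
  exists T; split => //; apply: (bounded_div wwD); rewrite -e.
  apply: boundedD; first exact: YR.
  by apply: boundedN; apply: bounded_rhs.
have dPw i : exists2 V, cst_denom V &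
    \sum_j tau (J i j) * (d (R j) - d (H j)) = tau w * V.
  have [T [PT Tb]] := PRT i.
  have /choice[C CE] : forall j, exists C : 'I_k.+1 -> A, forall l,
      drhs Q i (Y R) j l - drhs Q i (Y H) j l = w * w * C l.
    move=> j'; have /choice[C CE] : forall l, exists c : A,
        drhs Q i (Y R) j' l - drhs Q i (Y H) j' l = w * w * c.
      by move=> l; apply: congr_mod_drhs.
    by exists C.
  exists ((d w + d w) * tau T + tau w * d T +
     \sum_j \sum_l tau (w * C j l) * d (Y R j l)).
    have wb := cst_denom_bounded (distinguished_bounded wD).
    apply: cst_denomD; first apply: cst_denomD.
    - by apply: cst_denomM; [apply: cst_denomD|apply: cst_denom_tofrac].
    - by apply: cst_denomM; [apply: cst_denom_tofrac|apply: cst_denom_bounded].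
    apply: cst_denom_sum => j'; apply: cst_denom_sum => l.
    by apply: cst_denomM; [apply: cst_denom_tofrac|apply: cst_denom_bounded].
  rewrite J_dB PT der.2 der.2 !tofracM mulrDr; congr (_ + _).
    exact: square_derivative.
  rewrite mulr_sumr; apply: eq_bigr => j' _.
  rewrite mulr_sumr; apply: eq_bigr => l _.
  by rewrite -tofracB CE !tofracM !mulrA.
have dRH : cst_denom (d (R j) - d (H j)).
  have /choice[V VE] : forall i, exists V, cst_denom V /\
      \sum_j tau (J i j) * (d (R j) - d (H j)) = tau w * V.
    by move=> i; have [V ? ?] := dPw i; exists V.
  (* After multiplication by the determinant this is Cramer's rule, since [w = q * \det J]. *)
  have -> : d (R j) - d (H j) = tau q * \sum_i tau ((\adj J) j i) * V i.
    have D0 : tau (\det J) != 0 by rewrite tofrac_eq0 det_J_neq0.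
    apply: (mulfI D0); rewrite (cramer (fun j => d (R j) - d (H j))).
    transitivity (tau w * \sum_i tau ((\adj J) j i) * V i); last first.
      by rewrite wq tofracM [tau q * _]mulrC mulrA.
    rewrite mulr_sumr.
    by apply: eq_bigr => i _; rewrite (VE i).2 mulrCA.
  apply: cst_denomM; first exact: cst_denom_tofrac.
  apply: cst_denom_sum => i; apply: cst_denomM; last exact: (VE i).1.
  exact: cst_denom_tofrac.
rewrite -[d (H j)](subKr (d (R j))); apply: cst_denomB => //.
by apply: cst_denom_bounded; apply: (HR j).1.
Qed.

(* Once denominators in K[[t]] are cleared, dF lies in K[u][[t]] and solves the
   linearized system, whose only solution is 0. *)
Lemma dG_eq0 j i : (i < k)%N -> d (G j i) = 0.
Proof.
move=> ik.
(* [c1] clears the denominators of all [d (H j)], and [c2] those of all [d (G j i)]. *)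
have [c1 c1_0 /choice[h hE]] : exists2 c, c != 0 & forall j, exists h : A,
    tau (ps_cst c) * d (H j) = tau h.
  apply: common_denominator => [j' c e [h hE]|j']; last exact: cst_denom_dH.
  exists (ps_cst e * h); rewrite ps_cstM !tofracM -hE mulrA.
  by congr (_ * _); apply: mulrC.
have [c2 c2_0 gE] : exists2 c, c != 0 & forall p : 'I_n * 'I_k,
    exists g, tau (ps_cst c) * d (G p.1 p.2) = tau (ps_cst g).
  apply: common_denominator => [p c e [g gE]|p]; last exact: dcst.
  exists (e * g); rewrite !ps_cstM !tofracM -gE mulrA.
  by congr (_ * _); apply: mulrC.
pose c := tau (ps_cst (c1 * c2)).
have c0 : c != 0.
  rewrite tofrac_eq0 -(rmorph0 (@ps_cst K)) (inj_eq (@ps_cst_inj K)).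
  exact: mulf_neq0.
have cE : c = tau (ps_cst c1) * tau (ps_cst c2).
  by rewrite /c ps_cstM tofracM.
have /choice[g gE'] : forall j, exists g : nat -> {pseries K}, forall i,
    (i < k)%N -> c * d (G j i) = tau (ps_cst (g i)).
  move=> j'; have /choice[g gE'] : forall i, exists g, (i < k)%N ->
      c * d (G j' i) = tau (ps_cst g).
    (* Towers of height at most [k] do not see the indices from [k] on, where 0 is a default
       value. *)
    move=> i'; have [ik'|] := ltnP i' k; last by exists 0.
    have [g e] := gE (j', Ordinal ik'); exists (c1 * g) => _.
    by rewrite cE -mulrA e ps_cstM tofracM.
  by exists g.
have cH j' : c * d (H j') = tau (ps_cst c2 * h j').
  by rewrite cE mulrAC hE tofracM; apply: mulrC.
(* [X j] represents [c * d (F j)]. As a tower with constants in K[[t]], it has the iterates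
   [c * d (Delta^l F_j)] under [Delta]. *)
pose X j := tower v (fun i => ps_cst (g j i)) (ps_cst c2 * h j) k.
have cdY j' (l : 'I_k.+1) : c * d (Y H j' l) = tau (iter l (Delta a) (X j')).
  have lk : (l <= k)%N by rewrite -ltnS.
  rewrite /X (iter_Delta_of_tower a (g j') _ lk).
  rewrite [RHS](rmorph_tower tau) /Y (derivation_tower _ _ _ der (du _)).
  rewrite tower_scale cH.
  apply: eq_tower => m ml; apply: gE'.
  exact: leq_trans ml (leq_subr _ _).
have XE i' : X i' = \sum_j \sum_l drhs Q i' (Y H) j l * iter l (Delta a) (X j).
  apply/eqP; rewrite -tofrac_eq; apply/eqP.
  have -> : tau (X i') = c * d (Y H i' ord0) by rewrite cdY.
  rewrite dPH mulr_sumr (rmorph_sum tau); apply: eq_bigr => j' _.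
  rewrite mulr_sumr (rmorph_sum tau); apply: eq_bigr => l _.
  by rewrite mulrCA cdY; apply/esym; apply: (rmorphM tau).
have X0 j' : X j' = 0.
  have Phi0 m (Z Z' : 'I_n -> A) : (forall j, agree m (Z j) (Z' j)) ->
     forall i, agree m.+1
       (\sum_j \sum_l drhs Q i (Y H) j l * iter l (Delta a) (Z j))
       (\sum_j \sum_l drhs Q i (Y H) j l * iter l (Delta a) (Z' j)).
    move=> ZZ i'; apply: agree_sub_drhs => j'' l.
    by elim: (l : nat) => //= l' IH; apply: agree_Delta.
  apply: (contraction_unique Phi0 XE (G := fun=> 0)) => i' /=.
  rewrite big1 // => j'' _; rewrite big1 // => l _.
  by rewrite iter_Delta0 mulr0.
(* [g j i] is recovered from [X j = 0] by [Delta_const]. *)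
have := gE' j i ik; rewrite -(Delta_const_of_tower a (g j) (ps_cst c2 * h j) ik).
rewrite -/(X j) X0.
have -> : Delta_const a k (0 : A) i = 0.
  by rewrite /Delta_const iter_Delta0; apply: pseriesP => m /=; rewrite horner0.
rewrite !raddf0 => /eqP.
by rewrite mulf_eq0 (negPf c0) => /eqP.
Qed.

End Derivation.
End CentralArgument.

(** * Algebraicity *)

Section LiftDerivation.
Variable K : fieldType.
Local Notation A := {pseries {poly K}}.
Local Notation tau := (@FracField.tofrac A).
Local Notation tau1 := (@FracField.tofrac {pseries K}).

Definition cst_frac : {fraction {pseries K}} -> {fraction A} :=
  @frac_map {pseries K} {pseries {poly K}} (@ps_cst K).

HB.instance Definition _ := GRing.isZmodMorphism.Build
  {fraction {pseries K}} {fraction A} cst_frac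
  (frac_map_zmod_morphism (@ps_cst_inj K)).
HB.instance Definition _ := GRing.isMonoidMorphism.Build
  {fraction {pseries K}} {fraction A} cst_frac
  (frac_map_monoid_morphism (@ps_cst_inj K)).

Lemma cst_fracD : {morph cst_frac : x y / x + y}.
Proof. exact: raddfD. Qed.

Lemma cst_fracB : {morph cst_frac : x y / x - y}.
Proof. exact: raddfB. Qed.

Lemma cst_fracM : {morph cst_frac : x y / x * y}.
Proof. exact: rmorphM. Qed.

Lemma cst_frac0 : cst_frac 0 = 0.
Proof. exact: raddf0. Qed.

Lemma cst_frac1 : cst_frac 1 = 1.
Proof. exact: rmorph1. Qed.

Lemma cst_frac_tofrac c : cst_frac (tau1 c) = tau (ps_cst c).
Proof.
have := frac_mapE (@ps_cst_inj K) c (oner_neq0 _).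
by rewrite !rmorph1 !divr1.
Qed.

Lemma cst_frac_denom x : exists2 e : {pseries K}, e != 0 &
  exists g : {pseries K}, tau (ps_cst e) * cst_frac x = tau (ps_cst g).
Proof.
exists \d_(repr x); first exact: denom_ratioP.
exists \n_(repr x); rewrite /cst_frac /frac_map mulrC divfK // tofrac_eq0.
by rewrite -(rmorph0 (@ps_cst K)) (inj_eq (@ps_cst_inj K)) denom_ratioP.
Qed.

Lemma ps_cst_poly (p : {poly K}) :
  ps_cst (ps_of_poly p) = ps_of_poly (map_poly polyC p).
Proof. by apply: pseriesP => m; rewrite /= coef_map. Qed.

Lemma ps_t_cst : ps_t K = ps_cst (ps_of_poly 'X).
Proof. by rewrite ps_cst_poly map_polyX. Qed.

Lemma ps_inuC (c : K) : ps_inu c%:P = ps_cst (ps_of_poly c%:P).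
Proof. by rewrite ps_cst_poly map_polyC. Qed.

Hypothesis charK : [pchar K] =i pred0.

Lemma pchar_frac_pseries : [pchar {fraction {pseries K}}] =i pred0.
Proof.
pose phi : {rmorphism K -> {fraction {pseries K}}} :=
  (tau1 \o (@ps_of_poly K \o polyC))%FUN.
by move=> p; rewrite (fmorph_pchar phi) charK.
Qed.

Lemma pchar_frac_pseries_poly : [pchar {fraction A}] =i pred0.
Proof. by move=> p; rewrite (fmorph_pchar cst_frac) pchar_frac_pseries. Qed.

(* extends D1 by u' = 0 *)
Lemma lift_derivation (D1 : {fraction {pseries K}} -> {fraction {pseries K}}) :
  derivation_along idfun D1 -> (forall p, D1 (tau1 (ps_of_poly p)) = 0) ->
  exists d : A -> {fraction A}, [/\ derivation_along tau d, d (ps_t K) = 0,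
    forall p, d (ps_inu p) = 0 & forall c, d (ps_cst c) = cst_frac (D1 (tau1 c))].
Proof.
move=> der1 D1p.
have i0B (c c' : {pseries K}) :
    tau (ps_cst (c - c')) = tau (ps_cst c) - tau (ps_cst c').
  by rewrite (raddfB (@ps_cst K)) tofracB.
have i1B (c c' : {pseries K}) : cst_frac (D1 (tau1 (c - c'))) =
    cst_frac (D1 (tau1 c)) - cst_frac (D1 (tau1 c')).
  by rewrite tofracB (derivation_alongB der1) cst_fracB.
have i1M (c c' : {pseries K}) : cst_frac (D1 (tau1 (c * c'))) =
    cst_frac (D1 (tau1 c)) * tau (ps_cst c') +
    tau (ps_cst c) * cst_frac (D1 (tau1 c')).
  rewrite tofracM der1.2 /= cst_fracD !cst_fracM.
  by rewrite !cst_frac_tofrac.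
pose T0 : set ({fraction A} * {fraction A}) :=
  fun p => exists c, p = (tau (ps_cst c), cst_frac (D1 (tau1 c))).
have T0r : dual_subring T0.
  split.
  - exists 1; rewrite (rmorph1 (@ps_cst K)) !tofrac1.
    by rewrite (derivation_along1 der1) cst_frac0.
  - move=> _ _ _ _ [c [-> ->]] [c' [-> ->]]; exists (c - c').
    by rewrite i0B i1B.
  - move=> _ _ _ _ [c [-> ->]] [c' [-> ->]]; exists (c * c').
    by rewrite i1M ps_cstM tofracM.
have T0p : partial_derivation (dual_adjoin T0 (tau (ps_inu 'X)) 0).
  split; first exact: dual_adjoin_subring.
  move=> z [q [q' [Tq [q0 ->]]]]; rewrite mulr0 addr0.
  have /choice[g gE] := Tq.
  (* u is transcendental over K[[t]]: compare the coefficients of t^m, then those of u^i. *)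
  have g0 i : (i < size q)%N -> g i = 0.
    move=> iq; apply: pseriesP => m.
    have : \sum_(j < size q) ps_cst (g j) * ps_inu 'X ^+ j = 0 :> A.
      apply/eqP; rewrite -tofrac_eq0; apply/eqP; rewrite [RHS]q0 horner_coef.
      rewrite (rmorph_sum tau); apply: eq_bigr => j _.
      by have [-> _] := gE j; rewrite (rmorphM tau) (rmorphXn tau).
    move=> /(congr1 (fun B : A => pscoef B m)); rewrite pscoef_expansion.
    by move=> /(congr1 (fun p : {poly K} => p`_i)); rewrite coef_poly iq coef0.
  rewrite horner_coef big1 // => i _.
  (* The sum runs over the size of [q'], which may a priori exceed that of [q]; beyond it the
     coefficient of [q] is 0 and injectivity gives [g i = 0]. *)
  have [e ->] := gE i; have [iq|qi] := ltnP i (size q).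
    by rewrite g0 // tofrac0 (derivation_along0 der1) cst_frac0 mul0r.
  have : tau (ps_cst (g i)) = 0 by rewrite -e nth_default.
  move/eqP; rewrite tofrac_eq0 -(rmorph0 (@ps_cst K)) (inj_eq (@ps_cst_inj K)).
  by move/eqP => ->; rewrite tofrac0 (derivation_along0 der1) cst_frac0 mul0r.
have [D [der DT]] := partial_derivation_extend pchar_frac_pseries_poly T0p.
have Dc c : D (tau (ps_cst c)) = cst_frac (D1 (tau1 c)).
  by apply: DT; apply: dual_adjoin_sub => //; exists c.
have Dp p : D (tau (ps_cst (ps_of_poly p))) = 0 by rewrite Dc D1p cst_frac0.
exists (fun B => D (tau B)); split => //.
- exact: (derivation_comp tau der).
- by rewrite ps_t_cst Dp.
elim/poly_ind => [|p c IH].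
  by rewrite /ps_inu polyC0 rmorph0 tofrac0 (derivation_along0 der).
have -> : ps_inu (p * 'X + c%:P) = ps_inu p * ps_inu 'X + ps_inu c%:P.
  by rewrite /ps_inu polyCD polyCM rmorphD rmorphM.
rewrite tofracD tofracM der.1 der.2 IH ps_inuC Dp mul0r add0r addr0 /=.
by rewrite (DT _ _ (dual_adjoin_gen T0r _ _)) mulr0.
Qed.

End LiftDerivation.

Section Algebraicity.
Variables (K : fieldType) (charK : [pchar K] =i pred0).
Variables (n k : nat) (a : K).
Variables (f : 'I_n -> {poly K}) (Q : 'I_n -> {mpoly K[n * k.+1 + 2]}).
Local Notation A := {pseries {poly K}}.
Local Notation tau := (@FracField.tofrac A).
Local Notation tau1 := (@FracField.tofrac {pseries K}).

Variable F : 'I_n -> A.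
Hypothesis FE : forall i, F i = rhs f Q i (fun j l => iter l (Delta a) (F j)).

(** Otherwise a derivation of Frac K[[t]] over K[t] would send this constant to 1, but its lift to
    K[u][[t]] kills it by [dG_eq0]. *)
Lemma Delta_const_algebraic j i : (i < k)%N ->
  exists2 p : {poly {poly K}}, p != 0 &
    root (map_poly (@ps_of_poly K) p) (Delta_const a k (F j) i).
Proof.
move=> ik; set c := Delta_const _ _ _ _.
pose f1 : {rmorphism {poly K} -> {fraction {pseries K}}} :=
  (tau1 \o @ps_of_poly K)%FUN.
have f1E p : map_poly f1 p = map_poly tau1 (map_poly (@ps_of_poly K) p).
  by rewrite -map_poly_comp.
have [[p p0 pc]|ntr] := pselect (exists2 p : {poly {poly K}}, p != 0 &
    root (map_poly f1 p) (tau1 c)).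
  exists p => //; move: pc.
  by rewrite f1E /root horner_map tofrac_eq0.
have [D1 [der1 D1p D1c]] := transcendental_derivation (pchar_frac_pseries charK) ntr.
have [d [der dt du dc]] := lift_derivation charK der1 D1p.
have := @dG_eq0 _ _ _ _ _ _ _ FE _ der dt du _ j i ik.
rewrite -/c dc D1c cst_frac1 => e.
have /eqP : (1 : {fraction A}) = 0.
  by apply: e => c'; rewrite dc; apply: cst_frac_denom.
by rewrite oner_eq0.
Qed.

Lemma ratfun_embed_tofrac (P : {poly {poly K}}) :
  ratfun_embed (FracField.tofrac P) = tau (ps_of_poly P).
Proof.
have := frac_mapE (@ps_of_poly_inj {poly K}) P (oner_neq0 _).
by rewrite !rmorph1 !divr1.
Qed.

(** Otherwise a derivation over K(t,u) would take the value 1 at F_i. It kills the constants,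
    algebraic over K[t], hence F by [dF_eq0]. *)
Lemma solution_algebraic i : algebraicOver (@ratfun_embed K) (tau (F i)).
Proof.
apply: contrapT => ntr.
have [D [der Dr DF]] := transcendental_derivation (pchar_frac_pseries_poly charK) ntr.
have DP P : D (tau (ps_of_poly P)) = 0 by rewrite -ratfun_embed_tofrac Dr.
have derA : derivation_along tau (fun B => D (tau B)).
  exact: (derivation_comp tau der).
have /eqP : (1 : {fraction A}) = 0; last by rewrite oner_eq0.
rewrite -DF.
apply: (dF_eq0 FE derA (DP _) (fun p => DP _)) => j m mk.
pose f2 : {rmorphism {poly K} -> {fraction A}} :=
  (tau \o (@ps_cst K \o @ps_of_poly K))%FUN.
have f2E p : map_poly f2 p =
    map_poly tau (map_poly (@ps_cst K) (map_poly (@ps_of_poly K) p)).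
  by rewrite -!map_poly_comp.
apply: (derivation_algebraic (pchar_frac_pseries_poly charK) (f := f2)) => //.
- move=> p q /eqP; rewrite /= tofrac_eq => /eqP.
  by move/(@ps_cst_inj K)/(@ps_of_poly_inj K).
- by move=> p /=; rewrite ps_cst_poly.
have [p p0 /eqP pc] := Delta_const_algebraic j mk; exists p => //.
by rewrite f2E /root horner_map tofrac_eq0 horner_map pc rmorph0.
Qed.

End Algebraicity.

(** * Existence and uniqueness by contraction, together with algebraicity *)

Theorem theorem1 (K : fieldType) (charK0 : [pchar K] =i pred0)
    (n k : nat) (n_ge1 : (1 <= n)%N) (k_ge1 : (1 <= k)%N) (a : K)
    (f : 'I_n -> {poly K}) (Q : 'I_n -> {mpoly K[n * k.+1 + 2]}) :
  exists F : {ffun 'I_n -> {pseries {poly K}}},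
    [/\ forall i, F i = system_rhs a (f i) (Q i) F,
        forall G : {ffun 'I_n -> {pseries {poly K}}},
          (forall i, G i = system_rhs a (f i) (Q i) G) -> G = F
      & forall i, algebraicOver (@ratfun_embed K) (FracField.tofrac (F i))].
Proof.
pose Phi (F : 'I_n -> {pseries {poly K}}) i :=
  rhs f Q i (fun j l => iter l (Delta a) (F j)).
have ctr m (F G : 'I_n -> {pseries {poly K}}) :
    (forall i, agree m (F i) (G i)) -> forall i, agree m.+1 (Phi F i) (Phi G i).
  move=> FG i; apply: agree_rhs => j l.
  by elim: (l : nat) => //= l' IH; apply: agree_Delta.
have [F0 F0E] := contraction_fixpoint ctr.
pose F := [ffun i => F0 i].
have FF0 : (F : 'I_n -> _) = F0 by apply: funext => i; rewrite ffunE.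
have FE i : F i = Phi F i by rewrite FF0.
exists F; split.
- by move=> i; rewrite system_rhsE; apply: FE.
- move=> G GE; apply/ffunP.
  have GE' j : G j = Phi G j by rewrite [LHS]GE system_rhsE.
  exact: (contraction_unique ctr GE' FE).
- exact: (solution_algebraic charK0 FE).
Qed.
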